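(* Let $M=(S,\mathcal{I})$ be a matroid, $S_0\subseteq S$, and $w\in\mathbb{R}^S$. Define $w^*$ as follows. If $M$ has no basis contained in $S_0$, let $w^*=w$. Otherwise, let $S_1,\dots,S_k$ be the ground sets of the connected components of $M|S_0$; for $i\in[k]$ let $\delta_i^{\max}=\max\{w(e):e\in S_i\}$, $\delta_i^{\min}=\min\{w(e):e\in S_i\}$, $m_i=(\delta_i^{\max}+\delta_i^{\min})/2$; let $\varrho=\max_{i\in[k]}(\delta_i^{\max}-m_i)$ and $\mathrm{shift}_i=\varrho-(\delta_i^{\max}-m_i)$; let $w_H(s)=m_i+\mathrm{shift}_i$ for $s\in S_i$ ($i\in[k]$) and $w_H(s)=w(s)-\varrho$ for $s\in S\setminus S_0$; let $\Delta$ be the optimum value of the IM-Exists instance $(M,S_0,w_H,\|\cdot\|_\infty)$; and let $w^*(s)=w_H(s)+\Delta$ for $s\in S_0$ and $w^*(s)=w_H(s)-\Delta$ for $s\in S\setminus S_0$. Then $w^*$ is an optimal solution of the IM-All instance $(M,S_0,w,\|\cdot\|_\infty)$, and it can be computed in polynomial time.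
   Context: IM-All: find $w^*\in\mathbb{R}^S$ such that every basis of $M$ contained in $S_0$ is a maximum $w^*$-weight basis of $M$, minimizing $\|w-w^*\|_\infty=\max_s|w(s)-w^*(s)|$. IM-Exists instance $(M,S_0,w',\|\cdot\|_\infty)$: minimize $\|w'-w''\|_\infty$ over $w''\in\mathbb{R}^S$ such that some basis contained in $S_0$ is a maximum $w''$-weight basis. Connected components of a matroid: restrictions to the classes of the connected components of its circuit hypergraph. Polynomial time is measured in independence oracle calls and elementary operations. *)

(* Defs.v *)
From HB Require Import structures.
From mathcomp Require Import boolp classical_sets reals.
From mathcomp Require Import all_boot all_order all_algebra.

Set Implicit Arguments.
Unset Strict Implicit.
Unset Printing Implicit Defensive.

Import Order.TTheory GRing.Theory Num.Theory.
Local Open Scope ring_scope.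

(** * Matroids *)

Record matroid (S : finType) := Matroid {
  indep : {set {set S}};
  indep0 : set0 \in indep;
  indep_sub : forall I J : {set S}, I \subset J -> J \in indep -> I \in indep;
  indep_aug : forall I J : {set S}, I \in indep -> J \in indep ->
    (#|I| < #|J|)%N -> exists2 x, x \in J :\: I & x |: I \in indep }.

Definition basis (S : finType) (M : matroid S) (B : {set S}) : bool :=
  maxset (fun I => I \in indep M) B.

(* The restriction M|X has ground set X and independent sets
   {I in indep M, I \subset X}, so this is the set of circuits of M|X. *)
Definition circuits_in (S : finType) (M : matroid S) (X : {set S}) :
    {set {set S}} :=
  [set C | minset (fun D : {set S} => (D \subset X) && (D \notin indep M)) C].

(* Ground sets of the connected components of M|X. An element of X on no
   circuit of M|X is a class by itself, as [connect] is reflexive. *)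
Definition components (S : finType) (M : matroid S) (X : {set S}) :
    {set {set S}} :=
  equivalence_partition
    (connect (fun x y : S =>
       [exists C in circuits_in M X, (x \in C) && (y \in C)])) X.

(** * The two optimization problems *)

Definition weight (R : realType) (S : finType) (w : S -> R) (B : {set S}) : R :=
  \sum_(s in B) w s.

Definition max_weight_basis (R : realType) (S : finType) (M : matroid S)
    (w : S -> R) (B : {set S}) : Prop :=
  basis M B /\ (forall B' : {set S}, basis M B' -> weight w B' <= weight w B).

Definition linf_dist (R : realType) (S : finType) (w w' : S -> R) : R :=
  \big[Num.max/0]_(s : S) `|w s - w' s|.

Definition im_all (R : realType) (S : finType) (M : matroid S) (S0 : {set S}) :
    set (S -> R) :=
  fun w' => forall B : {set S}, basis M B -> B \subset S0 ->
    max_weight_basis M w' B.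

Definition im_exists (R : realType) (S : finType) (M : matroid S)
    (S0 : {set S}) : set (S -> R) :=
  fun w' => exists B : {set S}, [/\ basis M B, B \subset S0 &
    max_weight_basis M w' B].

Definition optimal_solution (R : realType) (S : finType) (F : set (S -> R))
    (w v : S -> R) : Prop :=
  F v /\ (forall v' : S -> R, F v' -> linf_dist w v <= linf_dist w v').

Definition optimum_value (R : realType) (S : finType) (F : set (S -> R))
    (w : S -> R) : R :=
  inf [set linf_dist w v | v in F]%classic.

(** * The weight function w^* *)

(* Maximum and minimum of w over a nonempty set A (0 if A is empty). *)
Definition max_on (R : realType) (S : finType) (w : S -> R) (A : {set S}) : R :=
  if [pick s in A] is Some s then \big[Num.max/w s]_(e in A) w e else 0.

Definition min_on (R : realType) (S : finType) (w : S -> R) (A : {set S}) : R :=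
  if [pick s in A] is Some s then \big[Num.min/w s]_(e in A) w e else 0.

Definition midpoint (R : realType) (S : finType) (w : S -> R) (A : {set S}) :
    R :=
  (max_on w A + min_on w A) / 2.

(* The maximized quantities are nonnegative, so the default value 0 only
   matters if S0 is empty. *)
Definition varrho (R : realType) (S : finType) (M : matroid S) (S0 : {set S})
    (w : S -> R) : R :=
  \big[Num.max/0]_(A in components M S0) (max_on w A - midpoint w A).

Definition shift (R : realType) (S : finType) (M : matroid S) (S0 : {set S})
    (w : S -> R) (A : {set S}) : R :=
  varrho M S0 w - (max_on w A - midpoint w A).

Definition wH (R : realType) (S : finType) (M : matroid S) (S0 : {set S})
    (w : S -> R) (s : S) : R :=
  if s \in S0 then
    let A := pblock (components M S0) s in midpoint w A + shift M S0 w A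
  else w s - varrho M S0 w.

Definition Delta (R : realType) (S : finType) (M : matroid S) (S0 : {set S})
    (w : S -> R) : R :=
  optimum_value (im_exists M S0) (wH M S0 w).

Definition wstar (R : realType) (S : finType) (M : matroid S) (S0 : {set S})
    (w : S -> R) (s : S) : R :=
  if [exists B : {set S}, basis M B && (B \subset S0)] then
    if s \in S0 then wH M S0 w s + Delta M S0 w
    else wH M S0 w s - Delta M S0 w
  else w s.

(** * Random access machines with real registers and an independence oracle

    The memory consists of arrays of natural numbers and arrays of reals.
    Natural numbers (indices, loop counters, characteristic vectors) can be
    added, subtracted and compared, but not multiplied, so that unit cost is
    a sound measure; real numbers only enter through the field operations
    and comparisons, and the only real constants are 0 and 1. A program is a
    finite syntactic object independent of the instance. *)

Inductive nexp : Type :=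
| NCst of nat
| NGet of nat & nexp               (* array name, index *)
| NAdd of nexp & nexp
| NSub of nexp & nexp.

Inductive rexp : Type :=
| RZero
| ROne
| RGet of nat & nexp
| RAdd of rexp & rexp
| RSub of rexp & rexp
| RMul of rexp & rexp
| RDiv of rexp & rexp.

Inductive bexp : Type :=
| BNle of nexp & nexp
| BRle of rexp & rexp
| BNot of bexp
| BAnd of bexp & bexp.

Inductive cmd : Type :=
| Skip
| NSet of nat & nexp & nexp        (* array name, index, value *)
| RSet of nat & nexp & rexp
| Query of nat & nexp & nat        (* array name and index of the answer;
                                      array holding the queried set *)
| Seq of cmd & cmd
| If of bexp & cmd & cmd
| While of bexp & cmd.

Record memory (R : realType) := Memory {
  nmem : nat -> nat -> nat;
  rmem : nat -> nat -> R }.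

Definition update (T : Type) (f : nat -> nat -> T) (a i : nat) (v : T) :
    nat -> nat -> T :=
  fun b j => if (b == a) && (j == i) then v else f b j.

Definition nset (R : realType) (m : memory R) (a i v : nat) : memory R :=
  Memory (update (nmem m) a i v) (rmem m).

Definition rset (R : realType) (m : memory R) (a i : nat) (v : R) : memory R :=
  Memory (nmem m) (update (rmem m) a i v).

Fixpoint neval (R : realType) (m : memory R) (e : nexp) : nat :=
  match e with
  | NCst k => k
  | NGet a i => nmem m a (neval m i)
  | NAdd e1 e2 => (neval m e1 + neval m e2)%N
  | NSub e1 e2 => (neval m e1 - neval m e2)%N
  end.

Fixpoint reval (R : realType) (m : memory R) (e : rexp) : R :=
  match e with
  | RZero => 0
  | ROne => 1
  | RGet a i => rmem m a (neval m i)
  | RAdd e1 e2 => reval m e1 + reval m e2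
  | RSub e1 e2 => reval m e1 - reval m e2
  | RMul e1 e2 => reval m e1 * reval m e2
  | RDiv e1 e2 => reval m e1 / reval m e2
  end.

Fixpoint beval (R : realType) (m : memory R) (b : bexp) : bool :=
  match b with
  | BNle e1 e2 => (neval m e1 <= neval m e2)%N
  | BRle e1 e2 => reval m e1 <= reval m e2
  | BNot b1 => ~~ beval m b1
  | BAnd b1 b2 => beval m b1 && beval m b2
  end.

(* Costs: every node of an evaluated expression is one operation. *)
Fixpoint ncost (e : nexp) : nat :=
  match e with
  | NCst _ => 1
  | NGet _ i => (ncost i).+1
  | NAdd e1 e2 | NSub e1 e2 => (ncost e1 + ncost e2).+1
  end.

Fixpoint rcost (e : rexp) : nat :=
  match e with
  | RZero | ROne => 1
  | RGet _ i => (ncost i).+1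
  | RAdd e1 e2 | RSub e1 e2 | RMul e1 e2 | RDiv e1 e2 =>
      (rcost e1 + rcost e2).+1
  end.

Fixpoint bcost (b : bexp) : nat :=
  match b with
  | BNle e1 e2 => (ncost e1 + ncost e2).+1
  | BRle e1 e2 => (rcost e1 + rcost e2).+1
  | BNot b1 => (bcost b1).+1
  | BAnd b1 b2 => (bcost b1 + bcost b2).+1
  end.

(* [exec orc c m m' t]: with oracle [orc], the program [c] started in memory
   [m] halts in memory [m'] after [t] elementary operations and oracle calls
   in total. The relation is deterministic. *)
Inductive exec (R : realType) (orc : (nat -> nat) -> bool) :
    cmd -> memory R -> memory R -> nat -> Prop :=
| exec_skip m :
    exec orc Skip m m 1
| exec_nset a i e m :
    exec orc (NSet a i e) m (nset m a (neval m i) (neval m e))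
      (ncost i + ncost e).+1
| exec_rset a i e m :
    exec orc (RSet a i e) m (rset m a (neval m i) (reval m e))
      (ncost i + rcost e).+1
| exec_query a i b m :
    exec orc (Query a i b) m (nset m a (neval m i) (nat_of_bool (orc (nmem m b))))
      (ncost i).+1
| exec_seq c1 c2 m1 m2 m3 t1 t2 :
    exec orc c1 m1 m2 t1 -> exec orc c2 m2 m3 t2 ->
    exec orc (Seq c1 c2) m1 m3 (t1 + t2)
| exec_if b c1 c2 m m' t :
    exec orc (if beval m b then c1 else c2) m m' t ->
    exec orc (If b c1 c2) m m' (bcost b + t)
| exec_while_false b c m :
    ~~ beval m b -> exec orc (While b c) m m (bcost b)
| exec_while_true b c m1 m2 m3 t1 t2 :
    beval m1 b -> exec orc c m1 m2 t1 -> exec orc (While b c) m2 m3 t2 ->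
    exec orc (While b c) m1 m3 (bcost b + t1 + t2).

(* The ground set S is numbered 0, ..., #|S| - 1 along [enum S]; an array
   represents the set of the elements at whose number it is nonzero. *)
Definition indep_oracle (S : finType) (M : matroid S) (f : nat -> nat) : bool :=
  [set s : S | f (enum_rank s) != 0%N] \in indep M.

(* Input: #|S| in cell 0 of natural array 0, the characteristic vector of S0
   in natural array 1, w in real array 0; all other cells are zero. *)
Definition input_memory (R : realType) (S : finType) (S0 : {set S})
    (w : S -> R) : memory R :=
  Memory
    (fun a i => match a with
       | 0 => if i == 0%N then #|S| else 0%N
       | 1 => nth 0%N [seq nat_of_bool (s \in S0) | s <- enum S] i
       | _ => 0%N
       end)
    (fun a i => match a with
       | 0 => nth 0 [seq w s | s <- enum S] i
       | _ => 0
       end).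

(* One program, with oracle access to M, computes f M S0 w (left in real
   array 1) on all instances, in time polynomial in #|S|. *)
Definition polytime_computable (R : realType)
    (f : forall S : finType, matroid S -> {set S} -> (S -> R) -> (S -> R)) :
    Prop :=
  exists (P : cmd) (c k : nat),
    forall (S : finType) (M : matroid S) (S0 : {set S}) (w : S -> R),
      exists (m : memory R) (t : nat),
        [/\ exec (indep_oracle M) P (input_memory S0 w) m t,
            forall s : S, rmem m 1 (enum_rank s) = f S M S0 w s &
            (t <= c * #|S|.+1 ^ k)%N].

(* Main.v *)
Require Import Defs.
From mathcomp Require Import boolp classical_sets reals.
From mathcomp Require Import all_boot all_order all_algebra.
From mathcomp Require Import zify ring lra.

(* Fix a basis [B] inside [S0] and call (e, f) an exchange if B - e + f is a
   basis. A locally optimal basis is optimal, so [v] is feasible for IM-All iff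
   [v f <= v e] for all exchanges, with equality if [f] is in [S0]; and the
   exchanges inside [S0] generate the components of M|S0. Hence every feasible
   [v] has distance at least D from [w], where D is the maximum of 0 and
   (w f - a e) / 2 over the exchanges with [f] outside [S0] and the pairs in a
   common component, and [a] is the componentwise minimum of [w]. The weights
   a + D on [S0] and w - D elsewhere attain D, and they are w^*: the optimum
   Delta of the IM-Exists instance equals D - varrho.

   The formula gives the algorithm: greedy basis of S0, basis test by single
   extensions, components by merging labels along exchanges, then a and D. *)

Set Implicit Arguments.
Unset Strict Implicit.
Unset Printing Implicit Defensive.

Import Order.TTheory GRing.Theory Num.Theory.
Local Open Scope ring_scope.

(** * Basis exchanges *)

Section MatroidExchange.

Variables (S : finType) (M : matroid S).
Implicit Types (B I J K X : {set S}) (e f s x y : S).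

Definition exchange B e f : bool :=
  [&& e \in B, f \notin B & f |: (B :\ e) \in indep M].

Lemma basis_indep B : basis M B -> B \in indep M.
Proof. by case/maxsetP. Qed.

(** Each augmentation from [J] adds an element of [J] outside the current set, so [I] grows to the
    size of [J] without leaving [I :|: J]. *)
Lemma indep_extend I J : I \in indep M -> J \in indep M -> (#|I| <= #|J|)%N ->
  exists K, [/\ K \in indep M, I \subset K, K \subset I :|: J & #|K| = #|J|].
Proof.
move=> iI iJ; move: {2}(#|J| - #|I|)%N (erefl (#|J| - #|I|)%N) => d.
elim: d I iI => [|d IHd] I iI dE leIJ.
  by exists I; split; rewrite ?subsetUl //; lia.
have [|x /setDP[xJ xI] ixI] := indep_aug iI iJ; first by lia.
have cxI : #|x |: I| = #|I|.+1 by rewrite cardsU1 xI.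
have [|| K [iK sIK sKJ cK]] := IHd _ ixI; rewrite ?cxI; [lia | lia |].
exists K; split=> //; first by apply: subset_trans sIK; apply: subsetUr.
apply: subset_trans sKJ _; rewrite -setUA.
by rewrite subUset subxx sub1set inE xJ orbT.
Qed.

Lemma card_indep_basis B I : basis M B -> I \in indep M -> (#|I| <= #|B|)%N.
Proof.
case/maxsetP=> iB maxB iI; rewrite leqNgt; apply/negP => lt.
have [x /setDP[_ xB] ixB] := indep_aug iB iI lt.
by move: (maxB _ ixB (subsetUr _ _)) xB => <-; rewrite setU11.
Qed.

Lemma card_bases B B' : basis M B -> basis M B' -> #|B| = #|B'|.
Proof.
move=> bB bB'; apply/eqP.
by rewrite eqn_leq !card_indep_basis ?basis_indep.
Qed.

Lemma indep_card_basis B I :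
  basis M B -> I \in indep M -> #|I| = #|B| -> basis M I.
Proof.
move=> bB iI cI; apply/maxsetP; split=> // J iJ sIJ.
by apply/esym/eqP; rewrite eqEcard sIJ cI card_indep_basis.
Qed.

Lemma indep_subset_basis B I : basis M B -> I \in indep M ->
  exists K, [/\ basis M K, I \subset K & K \subset I :|: B].
Proof.
move=> bB iI; have [|K [iK sIK sKB cK]] := indep_extend iI (basis_indep bB).
  exact: card_indep_basis.
by exists K; split=> //; apply: indep_card_basis cK.
Qed.

Lemma exchange_basis B e f :
  basis M B -> exchange B e f -> basis M (f |: (B :\ e)).
Proof.
move=> bB /and3P[eB fB iB]; apply: indep_card_basis bB iB _.
rewrite cardsU1 !inE (negbTE fB) andbF [RHS](cardsD1 e) eB; lia.
Qed.

(** Completing [f |: X] from [B] gives a basis that contains [f] and has the size of [B], so it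
    omits exactly one [e] of [B]. As it contains [X], this [e] avoids [X]; the choice of [X] thus
    steers which element is exchanged. *)
Lemma exchange_exists B X f : basis M B -> X \subset B -> f \notin B ->
  f |: X \in indep M -> exists2 e, e \notin X & exchange B e f.
Proof.
move=> bB sXB fB ifX.
have [K [bK sfXK sKB]] := indep_subset_basis bB ifX.
have fK : f \in K by apply: (subsetP sfXK); apply: setU11.
have [e eB eK] : exists2 e, e \in B & e \notin K.
  apply/subsetPn; apply: contra fB => sBK.
  suff -> : B = K by [].
  by apply/eqP; rewrite eqEcard sBK (card_bases bK bB) leqnn.
have eX : e \notin X.
  by apply: contra eK => eX; apply: (subsetP sfXK); rewrite inE eX orbT.
exists e => //; rewrite /exchange eB fB /=.
suff -> : f |: (B :\ e) = K by apply: basis_indep.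
apply/esym/eqP; rewrite eqEcard; apply/andP; split.
  apply/subsetP => y yK; have := subsetP sKB y yK.
  rewrite !inE; case: (eqVneq y f) => //= _ /orP[/(subsetP sXB) ->|->];
  by rewrite andbT; apply: contraNneq eK => <-.
by rewrite (card_bases bK bB) cardsU1 !inE (negbTE fB) andbF (cardsD1 e B) eB.
Qed.

(** The set [X] in the proof is the fundamental circuit of [f] over [B], without [f]. If no element
    of [X] could replace [f] in [B'], then [X] would lie in the span of [B' :\ f], and augmenting
    from [B'] would make [f |: X] independent. *)
Lemma symmetric_exchange B B' f : basis M B -> basis M B' ->
  f \in B' -> f \notin B -> exists2 e, exchange B e f & exchange B' f e.
Proof.
move=> bB bB' fB' fB.
pose X := [set e in B | exchange B e f].
have sXB : X \subset B by apply/subsetP => e; rewrite inE => /andP[].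
have iX : X \in indep M by apply: indep_sub sXB (basis_indep bB).
have nifX : f |: X \notin indep M.
  apply/negP => ifX; have [e eX xe] := exchange_exists bB sXB fB ifX.
  by move: eX; rewrite inE xe andbT; case/andP: xe => ->.
pose I := B' :\ f.
have iI : I \in indep M by apply: indep_sub (basis_indep bB'); apply: subD1set.
have cI : #|B'| = #|I|.+1 by rewrite (cardsD1 f B') fB'.
have [/existsP[e /andP[eX]]|] :=
  boolP [exists e, (e \in X) && exchange B' f e].
  by exists e => //; move: eX; rewrite inE => /andP[].
rewrite negb_exists => /forallP noe; case/negP: nifX.
(* Since no element of [X] extends [I] independently, [I] has maximum size among the independent
   subsets of [X :|: I]. *)
have augX J : J \in indep M -> J \subset X :|: I -> (#|J| <= #|I|)%N.
  move=> iJ sJ; rewrite leqNgt; apply/negP => lt.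
  have [e /setDP[eJ eI] ieI] := indep_aug iI iJ lt.
  have eX : e \in X by have := subsetP sJ e eJ;
    rewrite in_setU (negbTE eI) orbF.
  have ef : e != f by apply: contraNneq fB => <-; apply: (subsetP sXB).
  have eB' : e \notin B' by move: eI; rewrite !inE ef.
  by have := noe e; rewrite eX /exchange fB' eB' /= -/I ieI.
have [|J [iJ sXJ sJ cJ]] := indep_extend iX iI.
  by apply: augX => //; apply: subsetUl.
have [|x /setDP[xB' xJ] ixJ] := indep_aug iJ (basis_indep bB'); first by lia.
(* Any other [x] of [B'] lies in [I], and [x |: J] would exceed the bound [augX]. *)
have xf : x = f.
  apply/eqP; apply: contraNT xJ => xf.
  have := augX _ ixJ; rewrite cardsU1; case: (x \in J) => //= /(_ _) H.
  suff: (#|J|.+1 <= #|I|)%N by lia.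
  by apply: H; rewrite subUset sJ andbT sub1set !inE xf xB' orbT.
by rewrite -xf; apply: indep_sub ixJ; apply: setUS.
Qed.

End MatroidExchange.

(** * Local and global optimality of weighted bases *)

Section WeightedBases.

Variables (R : realType) (S : finType) (M : matroid S).
Implicit Types (B X : {set S}) (e f s x y : S) (u v : S -> R).

Lemma weight_exchange v B e f : exchange M B e f ->
  weight v (f |: (B :\ e)) = weight v B - v e + v f.
Proof.
case/and3P=> eB fB _; rewrite /weight big_setU1 ?inE ?(negbTE fB) ?andbF //=.
by rewrite (big_setD1 e eB) /=; ring.
Qed.

(** Induction on the size of [B' :\: B]. A symmetric exchange replaces some [f] of [B'] outside [B]
    by an [e] of [B]; the weight does not drop because [v f <= v e], and the difference loses
    [f]. *)
Lemma locally_optimal_basis v B X : basis M B -> B \subset X ->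
    (forall e f, f \in X -> exchange M B e f -> v f <= v e) ->
  forall B', basis M B' -> B' \subset X -> weight v B' <= weight v B.
Proof.
move=> bB sBX opt B'; move: {2}#|B' :\: B| (leqnn #|B' :\: B|) => d.
elim: d B' => [|d IHd] B' led bB' sB'X.
  have sB'B : B' \subset B.
    by rewrite -setD_eq0 -cards_eq0; rewrite leqn0 in led.
  have -> // : B' = B.
  by apply/eqP; rewrite eqEcard sB'B (card_bases bB bB') leqnn.
have [/eqP D0|/set0Pn[f /setDP[fB' fB]]] := boolP (B' :\: B == set0).
  by apply: IHd => //; rewrite D0 cards0.
have [e xB xB'] := symmetric_exchange bB bB' fB' fB.
have eB : e \in B by case/and3P: xB.
apply: (@le_trans _ _ (weight v (e |: (B' :\ f)))).
  rewrite (weight_exchange _ xB').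
  have := opt e f (subsetP sB'X f fB') xB; lra.
apply: IHd; last 2 first.
- exact: exchange_basis.
- rewrite subUset sub1set (subsetP sBX e eB) /=.
  by apply: subset_trans sB'X; apply: subD1set.
have -> : (e |: (B' :\ f)) :\: B = (B' :\: B) :\ f.
  apply/setP => y; rewrite !inE; case: (eqVneq y e) => [->|_].
    by rewrite eB andbF.
  by case: (y \in B); rewrite ?andbF.
have := cardsD1 f (B' :\: B); rewrite inE fB fB' /=; lia.
Qed.

Lemma max_weight_exchange v B e f :
  max_weight_basis M v B -> exchange M B e f -> v f <= v e.
Proof.
case=> bB maxB xB; have := maxB _ (exchange_basis bB xB).
rewrite (weight_exchange v xB); lra.
Qed.

(** Local optimality holds for both [v] and its negative, which gives the two inequalities. *)
Lemma weight_bases_eq v B (S0 : {set S}) : basis M B -> B \subset S0 ->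
    (forall e f, f \in S0 -> exchange M B e f -> v f = v e) ->
  forall B', basis M B' -> B' \subset S0 -> weight v B' = weight v B.
Proof.
move=> bB sB eqv B' bB' sB'; apply/eqP; rewrite eq_le; apply/andP; split.
  by apply: locally_optimal_basis bB sB _ _ bB' sB' => e f f0 /(eqv e f f0) ->.
have /= := @locally_optimal_basis (fun s => - v s) B S0 bB sB _ B' bB' sB'.
rewrite /weight !sumrN lerN2; apply=> e f f0 /(eqv e f f0) ->; exact: lexx.
Qed.

(* Membership in [im_all] only depends on the exchanges of a single basis. *)
Lemma im_all_exchange v B (S0 : {set S}) : basis M B -> B \subset S0 ->
  im_all M S0 v <-> (forall e f, exchange M B e f ->
    v f <= v e /\ (f \in S0 -> v f = v e)).
Proof.
move=> bB sB; split=> [allv e f xB|loc B1 bB1 sB1].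
  split; first exact: max_weight_exchange (allv B bB sB) xB.
  move=> f0; have bB' := exchange_basis bB xB.
  have [|_ maxB'] := allv _ bB'.
    rewrite subUset sub1set f0; apply: subset_trans sB; exact: subD1set.
  have := maxB' _ bB; have := max_weight_exchange (allv B bB sB) xB.
  rewrite (weight_exchange v xB); lra.
split=> // B' bB'.
rewrite (weight_bases_eq bB sB _ bB1 sB1); last first.
  by move=> e f f0 /loc[_ ->].
apply: (locally_optimal_basis bB (subsetT B) _ bB' (subsetT B')).
by move=> e f _ /loc[].
Qed.

End WeightedBases.

(** * Connected components and the exchanges of one basis *)

Section Components.

Variables (S : finType) (M : matroid S) (S0 : {set S}).
Implicit Types (B C X : {set S}) (e f s x y : S).

Definition circuit_rel x y : bool :=
  [exists C in circuits_in M S0, (x \in C) && (y \in C)].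

Lemma circuit_rel_sym : symmetric circuit_rel.
Proof. by move=> x y; apply: eq_existsb => C; congr andb; rewrite andbC. Qed.

Lemma connect_circuit_equiv : equivalence_rel (connect circuit_rel).
Proof.
apply/equivalence_relP; split; first exact: connect0.
move=> x y xy z; apply/idP/idP; last exact: connect_trans xy.
by apply: connect_trans; rewrite sym_connect_sym //; apply: circuit_rel_sym.
Qed.

Lemma partition_components : partition (components M S0) S0.
Proof.
by apply: equivalence_partitionP => x y z _ _ _; apply: connect_circuit_equiv.
Qed.

Lemma mem_component x y : x \in S0 -> y \in S0 ->
  (y \in pblock (components M S0) x) = connect circuit_rel x y.
Proof.
move=> x0 y0; rewrite pblock_equivalence_partition //.
by move=> {x0 y0}x {}y z _ _ _; apply: connect_circuit_equiv.
Qed.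

(** The dependent set [f |: B] contains a circuit. A circuit missing [e] would lie in the basis
    obtained by the exchange, and one missing [f] would lie in [B]; so it contains both. *)
Lemma exchange_component B e f : basis M B -> B \subset S0 -> f \in S0 ->
  exchange M B e f -> connect circuit_rel e f.
Proof.
move=> bB sB f0 /and3P[eB fB ix].
have dep : (f |: B \subset S0) && (f |: B \notin indep M).
  rewrite subUset sub1set f0 sB /=; apply/negP => ifB.
  by have := card_indep_basis bB ifB; rewrite cardsU1 fB ltnn.
have [C minC sC] := @minset_exists _
  (fun D : {set S} => (D \subset S0) && (D \notin indep M)) _ dep.
have depC : C \notin indep M by case/minsetP: minC => /andP[].
apply: connect1; apply/existsP; exists C; rewrite inE minC /=.
apply/andP; split; apply: contraR depC => xC.
  apply: indep_sub ix; apply/subsetP => y yC; have := subsetP sC y yC.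
  by rewrite !inE => /orP[->//|->];
    rewrite andbT (contraNneq _ xC) ?orbT // => <-.
apply: indep_sub (basis_indep bB); apply/subsetP => y yC.
have := subsetP sC y yC; rewrite !inE => /orP[/eqP yf|//].
by rewrite -yf yC in xC.
Qed.

(* If [v] is constant along the exchanges of one basis, then all bases inside
   [S0] have the same weight. Extending [C :\ x] to such a basis and replacing
   [y] by [x] shows that [v] is constant on every circuit [C]. *)
Lemma component_constant (R : realType) (v : S -> R) B x y :
    basis M B -> B \subset S0 ->
    (forall e f, f \in S0 -> exchange M B e f -> v f = v e) ->
  connect circuit_rel x y -> v x = v y.
Proof.
move=> bB sB eqv.
have eqw := weight_bases_eq bB sB eqv.
suff step a b : circuit_rel a b -> v a = v b.
  case/connectP=> p; elim: p x => [x _ -> //|z p IHp x /= /andP[xz zp] yE].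
  by rewrite (step _ _ xz); apply: IHp.
case/existsP=> C /and3P[]; rewrite inE => /minsetP[/andP[sC dC] minC] aC bC.
have [-> // | ab] := eqVneq a b.
have del c : c \in C -> C :\ c \in indep M.
  move=> cC; apply/negPn/negP => dep.
  have := minC (C :\ c); rewrite dep subD1set (subset_trans (subD1set _ _) sC).
  by move=> /(_ isT isT)/setP/(_ c); rewrite !inE eqxx cC.
have [K [bK sCK sKB]] := indep_subset_basis bB (del a aC).
have sK : K \subset S0.
  apply: subset_trans sKB _; rewrite subUset sB andbT.
  by apply: subset_trans sC; apply: subD1set.
have aK : a \notin K.
  apply: contra dC => aK; apply: indep_sub (basis_indep bK).
  by rewrite -(setD1K aC) subUset sub1set aK.
have sX : (C :\ b) :\ a \subset K.
  by apply: subset_trans sCK; apply/subsetP => z; rewrite !inE => /and3P[-> _].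
have [|e eX xK] := exchange_exists bK sX aK.
  by rewrite setD1K ?del // !inE ab.
(* If [e] differed from [b], it would lie outside [C], and all of [C] would survive in the
   independent set [a |: (K :\ e)]. *)
have eb : e = b.
  apply/eqP; apply: contraNT dC => eb; case/and3P: xK => _ _ ix.
  apply: indep_sub ix; apply/subsetP => z zC; rewrite !inE.
  have [//|za /=] := eqVneq z a; apply/andP; split; last first.
    by apply: (subsetP sCK); rewrite !inE za.
  apply: contraNneq eX => ze; rewrite -ze !inE za zC andbT /=.
  by rewrite ze.
have bK' := exchange_basis bK xK.
have := weight_exchange v xK; rewrite !eqw //; first by rewrite eb; lra.
rewrite subUset sub1set (subsetP sC a aC) /=.
by apply: subset_trans sK; apply: subD1set.
Qed.

End Components.

(** * An explicit formula for the optimum *)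

Section Distance.

Variables (R : realType) (S : finType).
Implicit Types (u v w : S -> R) (A : {set S}).

Lemma linf_dist_ge0 v w : 0 <= linf_dist v w.
Proof. exact: bigmax_ge_id. Qed.

Lemma linf_dist_ub v w s : `|v s - w s| <= linf_dist v w.
Proof. exact: le_bigmax. Qed.

Lemma linf_dist_le v w d :
  0 <= d -> (forall s, `|v s - w s| <= d) -> linf_dist v w <= d.
Proof. by move=> d0 le_d; apply: bigmax_le => // s _; apply: le_d. Qed.

Lemma max_on_ge w A s : s \in A -> w s <= max_on w A.
Proof.
rewrite /max_on => sA; case: pickP => [t tA|/(_ s)]; last by rewrite sA.
exact: le_bigmax_cond.
Qed.

Lemma max_on_le w A s c :
  s \in A -> (forall x, x \in A -> w x <= c) -> max_on w A <= c.
Proof.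
rewrite /max_on => sA le_c; case: pickP => [t tA|/(_ s)]; last by rewrite sA.
by apply: bigmax_le => //; apply: le_c.
Qed.

Lemma min_on_le w A s : s \in A -> min_on w A <= w s.
Proof.
rewrite /min_on => sA; case: pickP => [t tA|/(_ s)]; last by rewrite sA.
exact: bigmin_le_cond.
Qed.

Lemma min_on_ge w A s c :
  s \in A -> (forall x, x \in A -> c <= w x) -> c <= min_on w A.
Proof.
rewrite /min_on => sA le_c; case: pickP => [t tA|/(_ s)]; last by rewrite sA.
by apply: le_bigmin => //; apply: le_c.
Qed.

End Distance.

(** * The optimal radius, the weights attaining it, and their agreement with [wstar] *)

Section OptimalWeights.

Variables (R : realType) (S : finType) (M : matroid S) (S0 : {set S}).
Variables (B : {set S}) (w : S -> R).
Hypotheses (bB : basis M B) (sB : B \subset S0).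
Implicit Types (e f s x y : S) (v u : S -> R) (d : R).

Definition comp_min s : R := min_on w (pblock (components M S0) s).

(* Pairs in a common component and exchanges leaving [S0] generate the
   difference constraints that define [im_all]; a weight function within distance [d] of
   [w] can satisfy them only if [w f - comp_min e <= 2 * d]. *)
Definition constrained e f : bool :=
  [&& e \in S0, f \in S0 & connect (circuit_rel M S0) e f]
  || (f \notin S0) && exchange M B e f.

Definition radius_bound d : Prop :=
  0 <= d /\ (forall e f, constrained e f -> w f - comp_min e <= 2 * d).

(** A predicate rather than a value: the number that the program leaves in a register can then be
    shown to satisfy it directly. *)
Definition radius d : Prop :=
  radius_bound d /\ (forall d', radius_bound d' -> d <= d').

Lemma mem_pblock_comp s : s \in S0 -> s \in pblock (components M S0) s.
Proof.
by move=> s0; rewrite mem_pblock (cover_partition (partition_components M S0)).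
Qed.

Lemma comp_min_le s : s \in S0 -> comp_min s <= w s.
Proof. by move=> s0; apply: min_on_le; apply: mem_pblock_comp. Qed.

Lemma connect_pblock x y : x \in S0 -> y \in S0 ->
  connect (circuit_rel M S0) x y ->
  pblock (components M S0) x = pblock (components M S0) y.
Proof.
move=> x0 y0 xy; apply/esym/same_pblock; last by rewrite mem_component.
by have /and3P[] := partition_components M S0.
Qed.

Lemma comp_min_connect x y : x \in S0 -> y \in S0 ->
  connect (circuit_rel M S0) x y -> comp_min x = comp_min y.
Proof. by move=> x0 y0 xy; rewrite /comp_min (connect_pblock x0 y0 xy). Qed.

Lemma exchange_comp_min e f :
  f \in S0 -> exchange M B e f -> comp_min f = comp_min e.
Proof.
move=> f0 xB; have e0 : e \in S0 by case/and3P: xB => /(subsetP sB).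
by rewrite (comp_min_connect e0 f0 (exchange_component bB sB f0 xB)).
Qed.

Lemma pblock_compP s x : s \in S0 ->
  x \in pblock (components M S0) s ->
  x \in S0 /\ connect (circuit_rel M S0) s x.
Proof.
move=> s0 xs; have x0 : x \in S0.
  rewrite -(cover_partition (partition_components M S0)) -mem_pblock.
  have /and3P[_ tr _] := partition_components M S0.
  by rewrite (same_pblock tr xs).
by rewrite -mem_component.
Qed.

Definition wopt d s : R := if s \in S0 then comp_min s + d else w s - d.

(** An exchange inside [S0] stays in one component, on which [comp_min] is constant. For one leaving
    [S0], the inequality [w f - d <= comp_min e + d] is the radius bound. *)
Lemma wopt_im_all d : radius_bound d -> im_all M S0 (wopt d).
Proof.
case=> _ bd; apply/(im_all_exchange _ bB sB) => e f xB.
have e0 : e \in S0 by case/and3P: xB => /(subsetP sB).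
rewrite /wopt e0; case: ifPn => f0.
  by rewrite (exchange_comp_min f0 xB) lexx.
split=> //; have := bd e f; rewrite /constrained f0 xB orbT => /(_ isT); lra.
Qed.

Lemma linf_dist_wopt d : radius_bound d -> linf_dist w (wopt d) <= d.
Proof.
case=> d0 bd; apply: linf_dist_le => // s; rewrite /wopt ler_norml.
case: ifPn => s0; last by lra.
(* The pair [(s, s)] is constrained by reflexivity of [connect], so [w s] is at most
   [comp_min s + 2 * d]. *)
have := comp_min_le s0; have := bd s s.
rewrite /constrained s0 connect0 => /(_ isT); lra.
Qed.

(** A feasible [v] is constant on the component of [e]. Hence for each [x] there, [w f] exceeds
    [v f <= v e = v x] by at most one distance, and [v x] exceeds [w x] by at most another. *)
Lemma im_all_radius_bound v : im_all M S0 v -> radius_bound (linf_dist w v).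
Proof.
move=> allv; split=> [|e f c_ef]; first exact: linf_dist_ge0.
have /(im_all_exchange _ bB sB) locv := allv.
have e0 : e \in S0.
  by case/orP: c_ef => [/and3P[]//|/andP[_ /and3P[/(subsetP sB)]]].
suff: w f - 2 * linf_dist w v <= comp_min e by lra.
apply: min_on_ge (mem_pblock_comp e0) _ => x /(pblock_compP e0)[x0 ex].
have vxe : v e = v x.
  by apply: (component_constant bB sB _ ex) => a b b0 /locv[_ ->].
have vfe : v f <= v e.
  case/orP: c_ef => [/and3P[_ f0 ef]|/andP[_ /locv[]//]].
  by rewrite (component_constant bB sB _ ef) // => a b b0 /locv[_ ->].
have := linf_dist_ub w v f; have := linf_dist_ub w v x.
rewrite !ler_norml => /andP[? ?] /andP[? ?]; lra.
Qed.

Lemma radius_exists : exists d, radius d.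
Proof.
pose g (p : S * S) := (w p.2 - comp_min p.1) / 2.
(* The default 0 supplies [0 <= d] and is itself below every radius bound. *)
exists (\big[Num.max/0]_(p | constrained p.1 p.2) g p); split; first split.
- exact: bigmax_ge_id.
- move=> e f c_ef; have := @le_bigmax_cond _ _ _ 0 (e, f)
    (fun p : S * S => constrained p.1 p.2) g c_ef.
  rewrite {1}/g /=; lra.
move=> d [d0 bd]; apply: bigmax_le => // -[e f] /= /bd; rewrite /g /=; lra.
Qed.

Lemma wopt_optimal d :
  radius d -> optimal_solution (im_all M S0) w (wopt d).
Proof.
case=> bd min_d; split=> [|v allv]; first exact: wopt_im_all.
by apply: le_trans (linf_dist_wopt bd) (min_d _ (im_all_radius_bound allv)).
Qed.

Lemma component_eq A : A \in components M S0 ->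
  exists2 s, s \in S0 & A = pblock (components M S0) s.
Proof.
move=> cA; have /and3P[_ tr n0] := partition_components M S0.
have [A0|[s sA]] := set_0Vmem A; first by rewrite A0 (negbTE n0) in cA.
exists s; last by rewrite (def_pblock tr cA sA).
by rewrite -(cover_partition (partition_components M S0)); apply/bigcupP;
  exists A.
Qed.

(** The term of [varrho] for a component is half the spread of [w] on it. *)
Lemma varrho_ge s : s \in S0 -> w s - comp_min s <= 2 * varrho M S0 w.
Proof.
move=> s0; pose A := pblock (components M S0) s.
have cA : A \in components M S0.
  by rewrite pblock_mem // (cover_partition (partition_components M S0)).
have := @le_bigmax_cond _ _ _ 0 A (fun A => A \in components M S0)
  (fun A => max_on w A - midpoint w A) cA.
rewrite -/(varrho M S0 w) /midpoint /comp_min -/A.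
have := max_on_ge w (mem_pblock_comp s0); rewrite -/A; lra.
Qed.

Lemma varrho_ge0 : 0 <= varrho M S0 w.
Proof. exact: bigmax_ge_id. Qed.

Lemma varrho_le d : radius_bound d -> varrho M S0 w <= d.
Proof.
case=> d0 bd; apply: bigmax_le => // A /component_eq[s s0 ->].
rewrite /midpoint -/(comp_min s).
suff: max_on w (pblock (components M S0) s) <= 2 * d + comp_min s by lra.
apply: max_on_le (mem_pblock_comp s0) _ => x /(pblock_compP s0)[x0 sx].
have := bd s x; rewrite /constrained s0 x0 sx => /(_ isT); lra.
Qed.

(** Twice the midpoint is maximum plus minimum, so the maximum cancels. Thus [wH] has the form of
    [wopt] with [varrho] as its parameter, and shifting by [Delta] only increases that parameter. *)
Lemma wHE s : wH M S0 w s =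
  if s \in S0 then comp_min s + varrho M S0 w else w s - varrho M S0 w.
Proof.
by rewrite /wH /shift /midpoint -/(comp_min s); case: ifP => // _; field.
Qed.

(* Raising weights in [S0] and lowering them elsewhere does not preserve the
   optimality of a given basis, but it does preserve the existence of an optimal
   basis inside [S0]. The two bases [B] and [B'] are compared at the level sets
   [T] and [T'] of the weight of [f]. *)
Lemma im_exists_mono v u e f : im_exists M S0 v ->
    (forall s, s \in S0 -> v s <= u s) ->
    (forall s, s \notin S0 -> u s <= v s) ->
    (forall e f, f \in S0 -> exchange M B e f -> u f = u e) ->
  f \notin S0 -> exchange M B e f -> u f <= u e.
Proof.
case=> B' [bB' sB' maxB'] le_vu le_uv equ f0 xB.
rewrite leNgt; apply/negP => lt_ef.
pose T := [set s in S0 | u f <= u s]; pose T' := [set s in S0 | v f <= v s].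
have sT'T : T' \subset T.
  apply/subsetP => s; rewrite !inE => /andP[s0 fs]; rewrite s0 /=.
  by apply: le_trans (le_uv f f0) (le_trans fs (le_vu s s0)).
have fB' : f \notin B' by apply: contra f0 => /(subsetP sB').
(* [B :&: T] has maximum size among the independent subsets of [T]: an element of [T] extending it
   would be exchanged with an element of [B] outside [T], yet of the same [u]-weight. *)
have card_T I : I \in indep M -> I \subset T -> (#|I| <= #|B :&: T|)%N.
  move=> iI sIT; rewrite leqNgt; apply/negP => lt.
  have iBT : B :&: T \in indep M.
    by apply: indep_sub (basis_indep bB); apply: subsetIl.
  have [x /setDP[xI xBT] ix] := indep_aug iBT iI lt.
  have xT : x \in T := subsetP sIT x xI.
  have xB1 : x \notin B by apply: contra xBT; rewrite inE xT andbT.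
  have [a aBT xax] := exchange_exists bB (subsetIl B T) xB1 ix.
  have /andP[x0 fx] : (x \in S0) && (u f <= u x) by rewrite inE in xT.
  have aB : a \in B by case/and3P: xax.
  case/negP: aBT; rewrite !inE aB (subsetP sB a aB) /=.
  by rewrite -(equ _ _ x0 xax).
(* The assumption [u e < u f] puts [e] outside [T], so this set lies in [f |: (B :\ e)]. *)
have ifBT : f |: (B :&: T) \in indep M.
  have /and3P[_ _ ix] := xB; apply: indep_sub ix; apply: setUS.
  apply/subsetP => s; rewrite !inE => /and3P[-> _ fs]; rewrite andbT.
  by apply: contraTneq fs => ->; rewrite -ltNge.
have iB'T : B' :&: T \in indep M.
  by apply: indep_sub (basis_indep bB'); apply: subsetIl.
have c_fBT : #|f |: (B :&: T)| = #|B :&: T|.+1.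
  rewrite cardsU1 inE; case/and3P: xB => _ /negbTE -> _ //.
(* [K] has one element more than [B :&: T], so by [card_T] it cannot lie in [T] and must contain
   [f]. *)
have [|K [iK sK sK' cK]] := indep_extend iB'T ifBT.
  by rewrite c_fBT ltnW // ltnS card_T // subsetIr.
have fK : f \in K.
  apply/negPn/negP => fK; suff: (#|K| <= #|B :&: T|)%N by rewrite cK c_fBT ltnn.
  apply: card_T => //; apply/subsetP => s sK1; have := subsetP sK' s sK1.
  rewrite !inE; case: (eqVneq s f) => [sf|_]; first by rewrite -sf sK1 in fK.
  by case/orP=> /andP[].
have ifB'T' : f |: (B' :&: T') \in indep M.
  apply: indep_sub iK; rewrite subUset sub1set fK /=.
  by apply: subset_trans sK; apply: setIS.
(* Exchanging [f] with an [a] of [B'] outside [T'], where [v a < v f], would improve the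
   maximum-weight basis [B']. *)
have [a aT' xa] := exchange_exists bB' (subsetIl B' T') fB' ifB'T'.
have aB' : a \in B' by case/and3P: xa.
case/negP: aT'; rewrite !inE aB' (subsetP sB' a aB') /=.
exact: max_weight_exchange maxB' xa.
Qed.

(** A feasible [v] at distance [c] from [wH] makes [varrho + c] a radius bound, so [c] is at least
    [d - varrho]. The function [wopt d] attains this, being feasible and within [d - varrho] of [wH]
    at every element. *)
Lemma Delta_radius d : radius d -> Delta M S0 w = d - varrho M S0 w.
Proof.
case=> bd min_d; have rho_d := varrho_le bd; have rho0 := varrho_ge0.
pose D := [set linf_dist (wH M S0 w) v | v in im_exists M S0]%classic.
have lbD : lbound D (d - varrho M S0 w).
  move=> _ [v exv <-]; set c := linf_dist _ _.
  have c0 : 0 <= c by apply: linf_dist_ge0.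
  suff /min_d : radius_bound (varrho M S0 w + c) by lra.
  split=> [|e f]; first by lra.
  case/orP=> [/and3P[e0 f0 ef]|/andP[f0 xB]].
    by have := varrho_ge f0; rewrite (comp_min_connect e0 f0 ef); lra.
  have e0 : e \in S0 by case/and3P: xB => /(subsetP sB).
  (* The extreme weights within distance [c] of [wH]: above [v] on [S0] and below it elsewhere, as
     [im_exists_mono] requires. *)
  pose u s := if s \in S0 then wH M S0 w s + c else wH M S0 w s - c.
  have distc s := linf_dist_ub (wH M S0 w) v s.
  have: u f <= u e.
    apply: (im_exists_mono exv _ _ _ f0 xB) => [s s0|s s0|a b b0 xab].
    - by rewrite /u s0; have := distc s; rewrite ler_norml -/c => /andP[]; lra.
    - by rewrite /u (negbTE s0); have := distc s;
      rewrite ler_norml -/c => /andP[]; lra.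
    have a0 : a \in S0 by case/and3P: xab => /(subsetP sB).
    by rewrite /u a0 b0 !wHE a0 b0 (exchange_comp_min b0 xab).
  rewrite /u e0 (negbTE f0) !wHE e0 (negbTE f0); lra.
have Dopt : D (linf_dist (wH M S0 w) (wopt d)).
  exists (wopt d) => //; exists B; split=> //.
  exact: wopt_im_all bd B bB sB.
rewrite /Delta /optimum_value -/D; apply/eqP; rewrite eq_le; apply/andP; split.
  apply: (@le_trans _ _ (linf_dist (wH M S0 w) (wopt d))).
    by apply: ge_inf Dopt; exists (d - varrho M S0 w).
  apply: linf_dist_le => [|s]; first by lra.
  by rewrite wHE /wopt ler_norml; case: ifP => _; lra.
by apply: lb_le_inf lbD; exists (linf_dist (wH M S0 w) (wopt d)).
Qed.

Lemma wstarE d s : radius d -> wstar M S0 w s = wopt d s.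
Proof.
move=> rd; rewrite /wstar ifT; last first.
  by apply/existsP; exists B; rewrite bB sB.
by rewrite (Delta_radius rd) wHE /wopt; case: (s \in S0); ring.
Qed.

End OptimalWeights.

Lemma wstar_no_basis (R : realType) (S : finType) (M : matroid S)
    (S0 : {set S}) (w : S -> R) (s : S) :
  (forall B, basis M B -> ~~ (B \subset S0)) -> wstar M S0 w s = w s.
Proof.
move=> noB; rewrite /wstar ifN //; apply/existsPn => B.
by case: (boolP (basis M B)) => //= /noB.
Qed.

Lemma wstar_optimal (R : realType) (S : finType) (M : matroid S)
    (S0 : {set S}) (w : S -> R) :
  optimal_solution (im_all M S0) w (wstar M S0 w).
Proof.
have [/existsP[B /andP[bB sB]]|/existsPn noB] :=
  boolP [exists B : {set S}, basis M B && (B \subset S0)].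
  have [d rd] := radius_exists M S0 B w.
  have -> : wstar M S0 w = wopt M S0 w d.
    by apply/funext => s; apply: wstarE rd.
  exact: wopt_optimal rd.
(* Without a basis inside [S0] every weight function is feasible, and [w] is at distance 0 from
   itself. *)
have noB' B : basis M B -> ~~ (B \subset S0).
  by move=> bB; have := noB B; rewrite bB.
have -> : wstar M S0 w = w by apply/funext => s; apply: wstar_no_basis.
split=> [B /noB' /negP //|v _].
by apply: le_trans (linf_dist_ge0 w v); apply: linf_dist_le => // s;
  rewrite subrr normr0.
Qed.

(** * Programs with bounded loops *)

(* Programs whose only loops run a counter, kept in cell 0 of an array of its
   own, from 0 to #|S|. They denote total functions on memories, and the
   syntactic conditions in [well_formed] make the running time polynomial. *)
Inductive fcmd : Type :=
| FSkip
| FNSet of nat & nexp & nexp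
| FRSet of nat & nexp & rexp
| FQuery of nat & nexp & nat
| FSeq of fcmd & fcmd
| FIf of bexp & fcmd & fcmd
| FFor of nat & fcmd.

Definition counter (c : nat) : nexp := NGet c (NCst 0).

Definition guard (c : nat) : bexp := BNot (BNle (counter 0) (counter c)).

Definition incr (c : nat) : cmd := NSet c (NCst 0) (NAdd (counter c) (NCst 1)).

Fixpoint compile (p : fcmd) : cmd :=
  match p with
  | FSkip => Skip
  | FNSet a i e => NSet a i e
  | FRSet a i e => RSet a i e
  | FQuery a i b => Query a i b
  | FSeq p q => Seq (compile p) (compile q)
  | FIf b p q => If b (compile p) (compile q)
  | FFor c p =>
      Seq (NSet c (NCst 0) (NCst 0)) (While (guard c)
        (Seq (compile p) (incr c)))
  end.

Fixpoint nat_writes (p : fcmd) : seq nat :=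
  match p with
  | FSkip | FRSet _ _ _ => [::]
  | FNSet a _ _ | FQuery a _ _ => [:: a]
  | FSeq p q | FIf _ p q => nat_writes p ++ nat_writes q
  | FFor c p => c :: nat_writes p
  end.

Fixpoint real_writes (p : fcmd) : seq nat :=
  match p with
  | FSkip | FNSet _ _ _ | FQuery _ _ _ => [::]
  | FRSet a _ _ => [:: a]
  | FSeq p q | FIf _ p q => real_writes p ++ real_writes q
  | FFor _ p => real_writes p
  end.

(** The compiled guard rereads the bound from array 0 at each iteration. A loop must therefore keep
    its counter out of array 0, and its body may write neither array 0 nor the counter array. *)
Fixpoint well_formed (p : fcmd) : bool :=
  match p with
  | FSeq p q | FIf _ p q => well_formed p && well_formed q
  | FFor c p =>
      [&& c != 0%N, 0%N \notin nat_writes p, c \notin nat_writes p &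
        well_formed p]
  | _ => true
  end.

(** An upper bound: [FIf] pays for both branches. For [FFor], 9 is the reset of the counter (3) plus
    the final failing guard (6), and 12 is a passing guard (6) plus the increment (6). *)
Fixpoint cost (n : nat) (p : fcmd) : nat :=
  match p with
  | FSkip => 1
  | FNSet _ i e => (ncost i + ncost e).+1
  | FRSet _ i e => (ncost i + rcost e).+1
  | FQuery _ i _ => (ncost i).+1
  | FSeq p q => (cost n p + cost n q)%N
  | FIf b p q => (bcost b + (cost n p + cost n q))%N
  | FFor _ p => (9 + n * (12 + cost n p))%N
  end.

(** The crude estimate [sum], which adds exponents, serves every case; a loop raises the exponent by
    one. *)
Lemma cost_polynomial (p : fcmd) :
  exists c k, forall n, (cost n p <= c * n.+1 ^ k)%N.
Proof.
have sum c1 k1 c2 k2 n :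
    (c1 * n.+1 ^ k1 + c2 * n.+1 ^ k2 <= (c1 + c2) * n.+1 ^ (k1 + k2))%N.
  rewrite mulnDl leq_add // leq_mul2l leq_pexp2l ?orbT //; lia.
elim: p => [|a i e|a i e|a i b|p [c [k Hp]] q [c' [k' Hq]]
           |b p [c [k Hp]] q [c' [k' Hq]]|a p [c [k Hp]]] /=.
- by exists 1%N, 0%N => n.
- by exists (ncost i + ncost e).+1, 0%N => n; rewrite muln1.
- by exists (ncost i + rcost e).+1, 0%N => n; rewrite muln1.
- by exists (ncost i).+1, 0%N => n; rewrite muln1.
- exists (c + c')%N, (k + k')%N => n; apply: leq_trans (sum _ _ _ _ _).
  exact: leq_add.
- exists (bcost b + (c + c'))%N, (0 + (k + k'))%N => n.
  apply: leq_trans (sum _ _ _ _ _); rewrite muln1 leq_add2l.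
  by apply: leq_trans (sum _ _ _ _ _); apply: leq_add.
exists (9 + (12 + c))%N, (0 + (1 + (0 + k)))%N => n.
apply: leq_trans (sum _ _ _ _ _); rewrite muln1 leq_add2l.
rewrite expnD expn1 mulnCA; apply: leq_mul => //.
by apply: leq_trans (sum _ _ _ _ _); rewrite muln1 leq_add2l.
Qed.

(** * Denotations of bounded programs and their agreement with [exec] *)

Section Semantics.

Variables (R : realType) (orc : (nat -> nat) -> bool).
Implicit Types (m : memory R) (p q : fcmd).

Fixpoint loop (step : nat -> memory R -> memory R) (k j : nat) m : memory R :=
  if k is k'.+1 then loop step k' j.+1 (step j m) else m.

(** A loop reads its bound once and assigns the counter outright, whereas the compiled code rereads
    and increments; [well_formed] makes the two agree. *)
Fixpoint den p m : memory R :=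
  match p with
  | FSkip => m
  | FNSet a i e => nset m a (neval m i) (neval m e)
  | FRSet a i e => rset m a (neval m i) (reval m e)
  | FQuery a i b => nset m a (neval m i) (nat_of_bool (orc (nmem m b)))
  | FSeq p q => den q (den p m)
  | FIf b p q => if beval m b then den p m else den q m
  | FFor c p =>
      loop (fun j m => nset (den p m) c 0 j.+1) (nmem m 0 0) 0 (nset m c 0 0)
  end.

Lemma loop_ind (Inv : nat -> memory R -> Prop) step n m :
  Inv 0%N m ->
  (forall j m', (j < n)%N -> Inv j m' -> Inv j.+1 (step j m')) ->
  Inv n (loop step n 0 m).
Proof.
move=> I0 IS.
suff gen k j m' : (j + k = n)%N -> Inv j m' -> Inv n (loop step k j m').
  exact: gen (add0n n) I0.
elim: k j m' => [|k IHk] j m' jk Ij /=; first by rewrite -jk addn0.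
by apply: IHk; [lia | apply: IS => //; lia].
Qed.

Lemma den_nat_frame p m a i :
  a \notin nat_writes p -> nmem (den p m) a i = nmem m a i.
Proof.
elim: p m => [|b j e|b j e|b j b'|p IHp q IHq|b p IHp q IHq|c p IHp] m //=;
  rewrite ?inE ?mem_cat ?negb_or.
- by rewrite /update => /negbTE ->.
- by rewrite /update => /negbTE ->.
- by case/andP=> ap aq; rewrite IHq ?IHp.
- by case/andP=> ap aq; case: (beval m b); rewrite ?IHp ?IHq.
case/andP=> /negbTE ac ap.
apply: (@loop_ind (fun _ m' => nmem m' a i = nmem m a i)) => /=.
  by rewrite /update ac.
by move=> j m' _ /= Ij; rewrite /update ac IHp.
Qed.

Lemma den_real_frame p m a i :
  a \notin real_writes p -> rmem (den p m) a i = rmem m a i.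
Proof.
elim: p m => [|b j e|b j e|b j b'|p IHp q IHq|b p IHp q IHq|c p IHp] m //=;
  rewrite ?inE ?mem_cat ?negb_or.
- by rewrite /update => /negbTE ->.
- by case/andP=> ap aq; rewrite IHq ?IHp.
- by case/andP=> ap aq; case: (beval m b); rewrite ?IHp ?IHq.
move=> ap; apply: (@loop_ind (fun _ m' => rmem m' a i = rmem m a i)) => //=.
by move=> j m' _ Ij; rewrite IHp.
Qed.

Lemma exec_compile p m : well_formed p -> 0%N \notin nat_writes p ->
  exists2 t, exec orc (compile p) m (den p m) t & (t <= cost (nmem m 0 0) p)%N.
Proof.
elim: p m => [|a i e|a i e|a i b|p IHp q IHq|b p IHp q IHq|c p IHp] m /=.
- by exists 1%N => //; constructor.
- by exists (ncost i + ncost e).+1 => //; constructor.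
- by exists (ncost i + rcost e).+1 => //; constructor.
- by exists (ncost i).+1 => //; constructor.
- case/andP=> wp wq; rewrite mem_cat negb_or => /andP[p0 q0].
  have [t1 ex1 le1] := IHp m wp p0; have [t2 ex2 le2] := IHq (den p m) wq q0.
  exists (t1 + t2)%N; first exact: exec_seq ex1 ex2.
  by apply: leq_add => //; rewrite -(den_nat_frame m 0%N p0).
- case/andP=> wp wq; rewrite mem_cat negb_or => /andP[p0 q0].
  have [t1 ex1 le1] := IHp m wp p0; have [t2 ex2 le2] := IHq m wq q0.
  exists (bcost b + if beval m b then t1 else t2)%N.
    by apply: exec_if; case: (beval m b).
  by rewrite leq_add2l; case: (beval m b); lia.
case/and4P=> c0 p0 cp wp _; set n := nmem m 0 0.
set step := fun _ _ => _.
(* Stated for [k] remaining iterations from counter value [j]; the summand 6 pays for the failing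
   guard. *)
have loop_exec k j m' :
    (j + k = n)%N -> nmem m' c 0 = j -> nmem m' 0 0 = n ->
  exists2 t, exec orc (While (guard c) (Seq (compile p) (incr c))) m'
      (loop step k j m') t & (t <= 6 + k * (12 + cost n p))%N.
  elim: k j m' => [|k IHk] j m' jk cj n0.
    exists 6%N => //; apply: exec_while_false.
    by rewrite /= cj n0 -jk addn0 leqnn.
  have [t1 ex1 le1] := IHp m' wp p0.
  have cj' : nmem (den p m') c 0 = j by rewrite den_nat_frame.
  have stepE : step j m' = nset (den p m') c 0
      (neval (den p m') (NAdd (counter c) (NCst 1))).
    by rewrite /step /= cj' addn1.
  have [||| t2 ex2 le2] := IHk j.+1 (step j m').
  - by rewrite addSnnS.
  - by rewrite /step /= /update !eqxx.
  - by rewrite /step /= /update eq_sym (negbTE c0) den_nat_frame.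
  exists (6 + (t1 + 6) + t2)%N; last by rewrite n0 in le1; rewrite mulSn; lia.
  apply: exec_while_true ex2; first by rewrite /= cj n0 -ltnNge; lia.
  by apply: exec_seq ex1 _; rewrite stepE; apply: exec_nset.
have [||| t ex le] := loop_exec n 0%N (nset m c 0 0).
- by [].
- by rewrite /= /update !eqxx.
- by rewrite /= /update eq_sym (negbTE c0).
exists (3 + t)%N; last by lia.
by apply: exec_seq ex; apply: exec_nset.
Qed.

End Semantics.

(** * The algorithm *)

Definition nonzero (a : nat) (i : nexp) : bexp :=
  BNot (BNle (NGet a i) (NCst 0)).

Definition nat_eq (e1 e2 : nexp) : bexp := BAnd (BNle e1 e2) (BNle e2 e1).

Definition FWhen (b : bexp) (p : fcmd) : fcmd := FIf b p FSkip.

(* Natural arrays: 0 and 1 input, 2 the independent set [B], 3 oracle answer,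
   4 flag "B is not a basis", 5 component labels, 6 temporary, 7, 8, 9 counters.
   Real arrays: 0 input, 1 output, 2 component minima, 3 radius. *)
Definition greedy : fcmd :=
  FFor 7 (FWhen (nonzero 1 (counter 7))
    (FSeq (FNSet 2 (counter 7) (NCst 1))
    (FSeq (FQuery 3 (NCst 0) 2)
          (FIf (nonzero 3 (NCst 0)) FSkip (FNSet 2 (counter 7) (NCst 0)))))).

(** Single extensions suffice: an independent set is a basis exactly when no further element can be
    added. *)
Definition test_basis : fcmd :=
  FFor 7 (FIf (nonzero 2 (counter 7)) FSkip
    (FSeq (FNSet 2 (counter 7) (NCst 1))
    (FSeq (FQuery 3 (NCst 0) 2)
    (FSeq (FNSet 2 (counter 7) (NCst 0))
          (FWhen (nonzero 3 (NCst 0)) (FNSet 4 (NCst 0) (NCst 1))))))).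

(** The swap is undone before [p] runs, so that [p] and all later tests find [B] in array 2
    again. *)
Definition on_exchange (p : fcmd) : fcmd :=
  FWhen (BAnd (nonzero 2 (counter 7)) (BNot (nonzero 2 (counter 8))))
    (FSeq (FNSet 2 (counter 7) (NCst 0))
    (FSeq (FNSet 2 (counter 8) (NCst 1))
    (FSeq (FQuery 3 (NCst 0) 2)
    (FSeq (FNSet 2 (counter 8) (NCst 0))
    (FSeq (FNSet 2 (counter 7) (NCst 1))
          (FWhen (nonzero 3 (NCst 0)) p)))))).

Definition init_labels : fcmd := FFor 7 (FNSet 5 (counter 7) (counter 7)).

(** The label to be replaced is saved in array 6 first, because the loop overwrites the cell it is
    read from. *)
Definition merge_labels : fcmd :=
  FSeq (FNSet 6 (NCst 0) (NGet 5 (counter 8)))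
  (FFor 9 (FWhen (nat_eq (NGet 5 (counter 9)) (NGet 6 (NCst 0)))
            (FNSet 5 (counter 9) (NGet 5 (counter 7))))).

Definition compute_labels : fcmd :=
  FSeq init_labels
  (FFor 7 (FFor 8 (on_exchange (FWhen (nonzero 1 (counter 8)) merge_labels)))).

Definition compute_minima : fcmd :=
  FFor 7 (FSeq (FRSet 2 (counter 7) (RGet 0 (counter 7)))
    (FFor 8 (FWhen
      (BAnd (nonzero 1 (counter 8))
      (BAnd (nat_eq (NGet 5 (counter 7)) (NGet 5 (counter 8)))
            (BRle (RGet 0 (counter 8)) (RGet 2 (counter 7)))))
      (FRSet 2 (counter 7) (RGet 0 (counter 8)))))).

Definition half_gap : rexp :=
  RDiv (RSub (RGet 0 (counter 8)) (RGet 2 (counter 7))) (RAdd ROne ROne).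

Definition raise_radius : fcmd :=
  FWhen (BRle (RGet 3 (NCst 0)) half_gap) (FRSet 3 (NCst 0) half_gap).

Definition compute_radius : fcmd :=
  FFor 7 (FFor 8
    (FSeq
      (FWhen (BAnd (nonzero 1 (counter 7)) (BAnd (nonzero 1 (counter 8))
               (nat_eq (NGet 5 (counter 7)) (NGet 5 (counter 8)))))
        raise_radius)
      (on_exchange (FIf (nonzero 1 (counter 8)) FSkip raise_radius)))).

Definition output_optimum : fcmd :=
  FFor 7 (FIf (nonzero 1 (counter 7))
    (FRSet 1 (counter 7) (RAdd (RGet 2 (counter 7)) (RGet 3 (NCst 0))))
    (FRSet 1 (counter 7) (RSub (RGet 0 (counter 7)) (RGet 3 (NCst 0))))).

Definition output_input : fcmd :=
  FFor 7 (FRSet 1 (counter 7) (RGet 0 (counter 7))).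

Definition wstar_program : fcmd :=
  FSeq greedy (FSeq test_basis
    (FIf (nonzero 4 (NCst 0)) output_input
      (FSeq compute_labels (FSeq compute_minima
        (FSeq compute_radius output_optimum))))).

(** * Correctness of the algorithm *)

Section Correctness.

Variables (R : realType) (S : finType) (M : matroid S) (S0 : {set S}).
Variable w : S -> R.
Implicit Types (m : memory R) (p : fcmd) (A B I : {set S}) (e f s t x y : S).
Local Notation den := (den (indep_oracle M)).
Local Notation rank s := (nat_of_ord (enum_rank s)).

Lemma rank_eq s t : (rank s == rank t) = (s == t).
Proof. by rewrite (inj_eq val_inj) (inj_eq enum_rank_inj). Qed.

Lemma beval_nonzero m a i : beval m (nonzero a i) =
  (nmem m a (neval m i) != 0%N).
Proof. by rewrite /= leqn0. Qed.

Lemma beval_nat_eq m (e1 e2 : nexp) :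
  beval m (nat_eq e1 e2) = (neval m e1 == neval m e2).
Proof. by rewrite /= eqn_leq. Qed.

Lemma update_other (T : Type) (h : nat -> nat -> T) a i v b j :
  (b == a) = false -> update h a i v b j = h b j.
Proof. by rewrite /update => ->. Qed.

Definition unchanged (ns rs : seq nat) m m' : Prop :=
  (forall a i, a \notin ns -> nmem m' a i = nmem m a i) /\
  (forall a i, a \notin rs -> rmem m' a i = rmem m a i).

Lemma den_unchanged p m :
  unchanged (nat_writes p) (real_writes p) m (den p m).
Proof. by split=> a i; [apply: den_nat_frame | apply: den_real_frame]. Qed.

(** A loop rule indexed by the set [A] of elements already visited instead of a counter value. Each
    step also receives the frame conditions for the memory before the loop, so invariants need only
    mention what changes. *)
Lemma for_invariant (Inv : {set S} -> memory R -> Prop) c p m :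
    well_formed (FFor c p) -> nmem m 0 0 = #|S| ->
    Inv finset.set0 (nset m c 0 0) ->
    (forall A s m', s \notin A ->
       unchanged (c :: nat_writes p) (real_writes p) m m' ->
       nmem m' c 0 = rank s -> Inv A m' ->
       Inv (s |: A) (nset (den p m') c 0 (rank s).+1)) ->
  Inv [set: S]%SET (den (FFor c p) m).
Proof.
case/and4P=> c0 p0 cp wp m0 I0 IS /=; rewrite m0.
pose before j := [set s : S | (rank s < j)%N].
pose Inv' j m' := [/\ unchanged (c :: nat_writes p) (real_writes p) m m',
  nmem m' c 0 = j & Inv (before j) m'].
set step := fun _ _ => _.
suff: Inv' #|S| (loop step #|S| 0 (nset m c 0 0)).
  case=> _ _; congr Inv; apply/setP => s.
  by rewrite !inE ltn_ord.
apply: loop_ind => [|j m' lt_j [[fn fr] cj Ij]].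
  split; first split.
  - by move=> a i; rewrite inE negb_or /= /update => /andP[/negbTE ->].
  - by [].
  - by rewrite /= /update !eqxx.
  by have -> : before 0%N = finset.set0 by apply/setP => s; rewrite !inE.
pose s := enum_val (Ordinal lt_j).
have sj : rank s = j by rewrite /s enum_valK.
have Sj : before j.+1 = s |: before j.
  by apply/setP => t; rewrite !inE -rank_eq sj ltnS leq_eqVlt.
rewrite /step; split; first split.
- move=> a i aw; have := aw;
  rewrite inE negb_or /= /update => /andP[/negbTE -> /=].
  by move=> ap; rewrite den_nat_frame // fn.
- by move=> a i ap; rewrite /= den_real_frame // fr.
- by rewrite /= /update !eqxx.
have := IS (before j) s m'; rewrite -Sj sj; apply=> //.
by rewrite inE sj ltnn.
Qed.

Definition stores m a A : Prop :=
  forall s, (nmem m a (rank s) != 0%N) = (s \in A).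

Lemma stores_insert m a A s : stores m a A ->
  stores (nset m a (rank s) 1) a (s |: A).
Proof.
by move=> mA t; rewrite /= /update eqxx /= rank_eq !inE -mA; case: (t == s).
Qed.

Lemma stores_remove m a A s : stores m a A ->
  stores (nset m a (rank s) 0) a (A :\ s).
Proof.
by move=> mA t; rewrite /= /update eqxx /= rank_eq !inE -mA; case: (t == s).
Qed.

Lemma stores_oracle m a A : stores m a A ->
  indep_oracle M (nmem m a) = (A \in indep M).
Proof.
move=> mA; rewrite /indep_oracle.
suff -> : [set s | nmem m a (enum_rank s) != 0%N]%SET = A by [].
by apply/setP => s; rewrite inE mA.
Qed.

Lemma nat_of_bool_neq0 (b : bool) : (nat_of_bool b != 0%N) = b.
Proof. by case: b. Qed.

Definition input_ok m : Prop :=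
  [/\ nmem m 0 0 = #|S|, stores m 1 S0 & forall s, rmem m 0 (rank s) = w s].

Lemma unchanged_input ns rs m m' : unchanged ns rs m m' ->
  [&& 0%N \notin ns, 1%N \notin ns & 0%N \notin rs] -> input_ok m ->
    input_ok m'.
Proof.
case=> fn fr /and3P[n0 n1 r0] [m0 m1 mw]; split=> [|s|s]; first by rewrite fn.
- by rewrite fn.
by rewrite fr.
Qed.

Definition maximal_in_S0 I : Prop :=
  [/\ I \subset S0, I \in indep M &
      forall x, x \in S0 -> x \notin I -> x |: I \notin indep M].

(** The invariant is that the stored set is a maximal independent subset of the visited part of
    [S0]. *)
Lemma greedy_correct m : input_ok m -> (forall i, nmem m 2 i = 0%N) ->
  exists2 I, maximal_in_S0 I & stores (den greedy m) 2 I.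
Proof.
move=> [m0 m1 mw] m2.
pose Inv A m' :=
  exists I, [/\ I \subset S0 :&: A, I \in indep M, stores m' 2 I &
  forall x, x \in S0 :&: A -> x \notin I -> x |: I \notin indep M].
suff [I [sI iI mI maxI]] : Inv [set: S]%SET (den greedy m).
  by exists I => //; split; rewrite ?setIT in sI maxI.
apply: for_invariant => // [|A s m' sA [fn fr] cs [I [sI iI mI maxI]]].
  exists finset.set0; split;
    [exact: sub0set | exact: indep0 | move=> s | move=> x].
    by rewrite /= /update /= m2 inE.
  by rewrite !inE andbF.
have sI' : I \subset S0 :&: (s |: A).
  by apply: subset_trans sI _; apply: setIS; apply: subsetUr.
have sNI : s \notin I by apply: contra sA => /(subsetP sI);
  rewrite inE => /andP[].
rewrite /FWhen [den _ _]/= leqn0 cs (fn 1%N) // m1.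
case: ifPn => s0; last first.
  exists I; split=> // x; rewrite !inE => /andP[x0 /orP[/eqP xs|xA]].
    by rewrite -xs x0 in s0.
  by apply: maxI; rewrite inE x0.
have /= -> := stores_oracle (stores_insert s mI).
rewrite leqn0 {1}/update /= nat_of_bool_neq0.
case: ifPn => isI.
  exists (s |: I); split=> //.
  - by rewrite subUset sub1set sI' !inE s0 eqxx.
  - by move=> t; rewrite -(stores_insert s mI t).
  move=> x; rewrite !inE negb_or => /andP[x0 xsA] /andP[xs xI].
  have xA : x \in S0 :&: A by rewrite inE x0; case/orP: xsA => // /eqP /eqP;
    rewrite (negbTE xs).
  (* A rejected element stays rejected, since enlarging [I] preserves dependence. *)
  apply: contra (maxI x xA xI); apply: indep_sub; apply: setUS; exact: subsetUr.
exists I; split=> //.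
  move=> t; rewrite /= /update /= cs.
  have := stores_remove s (stores_insert s mI) t.
  by rewrite setU1K // /= /update /= cs.
move=> x; rewrite !inE => /andP[x0 /orP[/eqP -> //|xA]].
by apply: maxI; rewrite inE x0.
Qed.

Lemma den_seq p q m : den (FSeq p q) m = den q (den p m).
Proof. by []. Qed.

Lemma den_when b p m : den (FWhen b p) m = if beval m b then den p m else m.
Proof. by []. Qed.

Lemma test_basis_correct m I : nmem m 0 0 = #|S| -> nmem m 4 0 = 0%N ->
    stores m 2 I -> stores (den test_basis m) 2 I /\
  (nmem (den test_basis m) 4 0 != 0%N) =
    [exists x, (x \notin I) && (x |: I \in indep M)].
Proof.
move=> m0 m4 mI.
pose Inv A m' := stores m' 2 I /\
  (nmem m' 4 0 != 0%N) = [exists x in A, (x \notin I) && (x |: I \in indep M)].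
suff [? ->] : Inv [set: S]%SET (den test_basis m).
  by split=> //; apply: eq_existsb => x; rewrite inE.
apply: for_invariant => // [|A s m' sA _ cs [mI' flag]].
  split=> //=; rewrite /update /= m4; apply/esym/existsP => -[x].
  by rewrite inE.
have exA : [exists x in s |: A, (x \notin I) && (x |: I \in indep M)] =
    (s \notin I) && (s |: I \in indep M) || (nmem m' 4 0 != 0%N).
  rewrite flag; apply/existsP/idP => [[x]|].
    rewrite !inE => /andP[/orP[/eqP ->|xA] xx]; first by rewrite xx.
    by apply/orP; right; apply/existsP; exists x; rewrite xA.
  case/orP => [ss|/existsP[x /andP[xA xx]]].
    by exists s; rewrite !inE eqxx.
  by exists x; rewrite !inE xA orbT.
rewrite /Inv exA /FWhen [den _ _]/= leqn0 cs mI'.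
case: ifPn => [sI|sNI]; first by split.
have /= -> := stores_oracle (stores_insert s mI').
rewrite leqn0 {1}/update /= !{1}/update /= nat_of_bool_neq0 cs /=.
split.
  move=> t; have := stores_remove s (stores_insert s mI') t.
  by rewrite setU1K //; case: ifP => _; rewrite /= /update /=.
by case: ifP => _; rewrite /= /update.
Qed.

(** If [I] can be extended at all, it is smaller than any basis; a basis inside [S0] would then
    augment [I] within [S0], against its maximality there. *)
Lemma maximal_in_S0_basis I : maximal_in_S0 I ->
  if [exists x, (x \notin I) && (x |: I \in indep M)]
  then forall B, basis M B -> ~~ (B \subset S0) else basis M I.
Proof.
case=> sI iI maxI; case: ifPn => [/existsP[x /andP[xI ixI]] B bB|/existsPn noX].
  apply/negP => sB.
  have ltIB : (#|I| < #|B|)%N.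
    by have := card_indep_basis bB ixI; rewrite cardsU1 xI.
  have [y /setDP[yB yI] iyI] := indep_aug iI (basis_indep bB) ltIB.
  by have := maxI y (subsetP sB y yB) yI; rewrite iyI.
apply/maxsetP; split=> // J iJ sIJ; apply/eqP; rewrite eqEsubset sIJ andbT.
apply/subsetP => x xJ; have := noX x; rewrite negb_and negbK.
case/orP=> // /negP[]; apply: indep_sub iJ.
by rewrite subUset sub1set xJ.
Qed.

(** * Labels, minima and radius relative to a basis inside [S0] *)

Section Basis.

Variable B : {set S}.
Hypotheses (bB : basis M B) (sB : B \subset S0).

Definition pair_at e f m : Prop := nmem m 7 0 = rank e /\ nmem m 8 0 = rank f.

(** Array 2 is restored only as a set, since a nonzero cell may come back as 1; this is why
    [unchanged] excepts it. *)
Lemma on_exchange_den p m e f : stores m 2 B -> pair_at e f m ->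
  exists m', [/\ stores m' 2 B, unchanged [:: 2; 3] [::] m m' &
    den (on_exchange p) m = if exchange M B e f then den p m' else m'].
Proof.
move=> mB [ce cf]; rewrite /on_exchange /exchange den_when.
have -> : beval m (BAnd (nonzero 2 (counter 7)) (BNot (nonzero 2 (counter 8))))
  =
    (e \in B) && (f \notin B).
  by rewrite /= !leqn0 ce cf !mB.
rewrite andbA; case: ifPn => [/andP[eB fB]|_]; last by exists m.
rewrite 5!den_seq den_when /= ce.
rewrite ![update _ _ _ _ 7 0]update_other // ce.
rewrite ![update _ _ _ _ 8 0]update_other // cf.
have /= -> := stores_oracle (stores_insert f (stores_remove e mB)).
set b := (_ \in _).
set m' := nset (nset _ 2 _ 0) 2 _ 1; exists m'; split.
- move=> t; rewrite /m' /= /update /= !rank_eq -mB.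
  case: (eqVneq t e) => [->|_]; first by rewrite mB eB.
  by case: (eqVneq t f) => [->|//]; rewrite mB (negbTE fB).
- split=> // a i; rewrite !inE /m' /= /update /=.
  by case/norP=> /negbTE -> /negbTE ->.
by rewrite {1}/update /= {1}/update /= {1}/update /= leqn0 nat_of_bool_neq0.
Qed.

Local Notation label m s := (nmem m 5 (rank s)).

Lemma init_labels_correct m s : nmem m 0 0 = #|S| ->
  label (den init_labels m) s = rank s.
Proof.
move=> m0; pose Inv A m' := forall t, t \in A -> label m' t = rank t.
suff : Inv [set: S]%SET (den init_labels m) by apply; rewrite inE.
apply: for_invariant => // [t|A t m' _ _ ct IA x]; first by rewrite inE.
rewrite /= {1}/update /= ct /update /= rank_eq !inE.
by case: eqVneq => [->|_] //=; apply: IA.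
Qed.

Lemma merge_labels_correct m e f t : nmem m 0 0 = #|S| -> pair_at e f m ->
  label (den merge_labels m) t =
    if label m t == label m f then label m e else label m t.
Proof.
move=> m0 [ce cf]; rewrite /merge_labels den_seq.
set m1 := den _ m; set loop := FFor _ _.
pose Inv A m' := forall x, label m' x =
  if (x \in A) && (label m x == label m f) then label m e else label m x.
suff : Inv [set: S]%SET (den loop m1) by move=> ->; rewrite inE.
apply: for_invariant => // [x|A s m' sA [fn _] cs IA x]; first by rewrite inE.
rewrite den_when beval_nat_eq /= cs (fn 6%N) // (fn 7%N) //.
rewrite /= cf /update /= ce.
(* By [if_same], the label of [e] is intact even if [e] was already visited: it could only be
   replaced by itself. *)
rewrite (IA s) (negbTE sA) /= (IA e) if_same !inE.
case: ifPn => ls.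
  rewrite /= /update /= rank_eq.
  by case: (eqVneq x s) => [->|_] /=; [rewrite ls | apply: IA].
by case: (eqVneq x s) => [->|_] /=; rewrite ?IA // (negbTE ls) ?andbF.
Qed.

Definition labels_ok m : Prop := forall x y, x \in S0 -> y \in S0 ->
  (label m x == label m y) = connect (circuit_rel M S0) x y.

Definition labels_sound m : Prop :=
  forall x y, label m x = label m y -> connect (circuit_rel M S0) x y.

Definition labels_merged (P : S -> S -> bool) m : Prop :=
  forall e f, P e f -> f \in S0 -> exchange M B e f -> label m e = label m f.

Lemma labels_merged_ok m : labels_sound m ->
  labels_merged (fun _ _ => true) m ->
  labels_ok m.
Proof.
move=> snd mrg x y x0 y0; apply/eqP/idP => [/snd //|xy].
(* Labels are cast to [R] so that [component_constant] applies to them as a weight function. *)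
have /(_ R (fun s => (label m s)%:R)) := component_constant bB sB _ xy.
by move=> cst; apply/eqP;
  rewrite -(eqr_nat R) cst // => e f f0 /(mrg e f isT f0) ->.
Qed.

(** Merging the classes of [e] and [f] is sound because an exchange inside [S0] connects them.
    Earlier merges persist because the new label depends only on the old one. *)
Lemma labels_step (P : S -> S -> bool) m e f : nmem m 0 0 = #|S| ->
    stores m 1 S0 -> stores m 2 B -> pair_at e f m ->
    labels_sound m -> labels_merged P m ->
  let m' := den (on_exchange (FWhen (nonzero 1 (counter 8)) merge_labels)) m in
  [/\ stores m' 2 B, labels_sound m' &
      labels_merged (fun a b => P a b || (a == e) && (b == f)) m'].
Proof.
move=> m0 m1 mB [ce cf] snd mrg md; rewrite {}/md.
have [m' [mB' [fn _] ->]] :=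
  on_exchange_den (FWhen (nonzero 1 (counter 8)) merge_labels) mB (conj ce cf).
have lab t : label m' t = label m t by rewrite fn.
have snd' : labels_sound m' by move=> x y; rewrite !lab; apply: snd.
have mrg' : labels_merged P m' by move=> a b; rewrite !lab; apply: mrg.
case: ifPn => [xef|nxef]; last first.
  split=> // a b /orP[|/andP[/eqP -> /eqP ->] _]; first exact: mrg'.
  by rewrite (negbTE nxef).
have ce' : pair_at e f m' by rewrite /pair_at !fn.
rewrite den_when beval_nonzero [neval _ _]/= !fn // cf m1.
case: ifPn => [f0|nf0]; last first.
  split=> // a b /orP[|/andP[_ /eqP ->]]; first exact: mrg'.
  by rewrite (negbTE nf0).
have lab' t := merge_labels_correct t (etrans (fn 0%N 0%N isT) m0) ce'.
have ef := exchange_component bB sB f0 xef.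
have csym := sym_connect_sym (circuit_rel_sym M S0).
split.
- by move=> t; rewrite den_nat_frame.
- move=> x y; rewrite !lab'.
  case: (eqVneq (label m' x) (label m' f)) => [/snd' xf|_];
    case: (eqVneq (label m' y) (label m' f)) => [/snd' yf|_].
  + by move=> _; rewrite csym in yf; apply: connect_trans xf yf.
  + by move/snd' => ey; rewrite csym in ef;
    apply: connect_trans xf (connect_trans ef ey).
  + by move/snd' => xe; rewrite csym in yf;
    apply: connect_trans xe (connect_trans ef yf).
  + exact: snd'.
move=> a b /orP[Pab|/andP[/eqP -> /eqP ->] _ _]; last first.
  by rewrite !lab' eqxx if_same.
by move=> b0 xab; rewrite !lab' (mrg' a b Pab b0 xab).
Qed.

Lemma compute_labels_correct m : input_ok m -> stores m 2 B ->
  stores (den compute_labels m) 2 B /\ labels_ok (den compute_labels m).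
Proof.
move=> m_ok mB; rewrite /compute_labels den_seq; set m1 := den _ m.
have [m0 m1S0 _] : input_ok m1.
  exact: unchanged_input (den_unchanged init_labels m) _ m_ok.
have mB1 : stores m1 2 B by move=> s; rewrite /m1 den_nat_frame.
have lab1 s : label m1 s = rank s by apply: init_labels_correct; case: m_ok.
pose Inv (P : S -> S -> bool) m' :=
  [/\ stores m' 2 B, labels_sound m' & labels_merged P m'].
set loop := FFor 7 _.
suff [mB2 snd mrg] : Inv (fun a _ => a \in [set: S]%SET) (den loop m1).
  by split=> //; apply: labels_merged_ok => // a b _; apply: mrg; rewrite inE.
apply: (for_invariant (Inv := fun A => Inv (fun a _ => a \in A))) => //.
  split=> // [x y|a b]; last by rewrite inE.
  by rewrite /= /update /= !lab1 => /eqP; rewrite rank_eq => /eqP ->;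
    apply: connect0.
move=> A e m2 eA [fn _] ce I2.
set body := FFor 8 _.
(* Pairs treated so far: every row in [A], and in row [e] the columns in [C]. *)
pose Inv2 (C : {set S}) := Inv (fun a b => (a \in A) || (a == e) && (b \in C)).
suff [mB2 snd mrg] : Inv2 [set: S]%SET (den body m2).
  split=> // a b; rewrite !inE => ab; apply: mrg.
  by rewrite inE andbT orbC.
apply: for_invariant => //; first by rewrite fn.
  case: I2 => mB2 snd mrg; split=> // a b; rewrite inE andbF orbF; exact: mrg.
move=> C f m3 fC [fn' _] cf [mB3 snd3 mrg3].
have m30 : nmem m3 0 0 = #|S| by rewrite fn' // fn.
have m31 : stores m3 1 S0 by move=> s; rewrite fn' // fn.
have ce3 : pair_at e f m3 by rewrite /pair_at fn'.
have [mB4 snd4 mrg4] := labels_step m30 m31 mB3 ce3 snd3 mrg3.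
split=> // a b; rewrite !inE => ab; apply: mrg4.
by move: ab; case: (a \in A); case: (a == e); case: (b == f); case: (b \in C).
Qed.

Definition minima_ok m : Prop :=
  forall s, s \in S0 -> rmem m 2 (rank s) = comp_min M S0 w s.

Lemma compute_minima_correct m : input_ok m -> labels_ok m ->
  minima_ok (den compute_minima m).
Proof.
move=> [m0 m1 mw] lab.
pose Inv A m' := forall s, s \in A -> s \in S0 -> rmem m' 2 (rank s) =
  comp_min M S0 w s.
suff I : Inv [set: S]%SET (den compute_minima m) by move=> s; apply: I;
  rewrite inE.
apply: for_invariant => // [s|A s m' sA [fn fr] cs IA]; first by rewrite inE.
rewrite den_seq; set m2 := den _ m'; set body := FFor 8 _.
(* The running value lies between [comp_min] and the weights seen so far in the component; once all
   elements are visited, the two bounds meet. *)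
pose Inv2 (C : {set S}) m3 :=
  (forall x, x != s -> rmem m3 2 (rank x) = rmem m' 2 (rank x)) /\
  (s \in S0 -> comp_min M S0 w s <= rmem m3 2 (rank s) /\
     forall x, x \in C -> x \in S0 -> connect (circuit_rel M S0) s x ->
       rmem m3 2 (rank s) <= w x).
suff [oth min] : Inv2 [set: S]%SET (den body m2).
  move=> x; rewrite !inE /=.
  have [-> _ s0|xs /= xA x0] := eqVneq x s; last by rewrite oth // IA.
  have [ge le] := min s0; apply/eqP; rewrite eq_le ge andbT.
  apply: min_on_ge (mem_pblock_comp M s0) _ => y /(pblock_compP s0)[y0 sy].
  by apply: le; rewrite ?inE.
have nm2 a i : nmem m2 a i = nmem m' a i by [].
have rm2 a i : rmem m2 a i = update (rmem m') 2 (rank s) (w s) a i.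
  by rewrite /m2 /= cs fr // mw.
apply: for_invariant => // [||C x m3 xC [fn' fr'] cx [oth min]].
- by rewrite nm2 fn.
- split=> [x /negbTE xs|s0]; first by rewrite [LHS]rm2 /update /= rank_eq xs.
  split=> [|x]; last by rewrite inE.
  by rewrite [leRHS]rm2 /update /= eqxx comp_min_le.
have cs3 : nmem m3 7 0 = rank s by rewrite fn'.
rewrite den_when.
have -> : beval m3 (BAnd (nonzero 1 (counter 8))
      (BAnd (nat_eq (NGet 5 (counter 7)) (NGet 5 (counter 8)))
            (BRle (RGet 0 (counter 8)) (RGet 2 (counter 7))))) =
    [&& x \in S0, label m s == label m x & w x <= rmem m3 2 (rank s)].
  rewrite /= leqn0 -eqn_leq cs3 cx !fn' // fr' // !nm2 !fn // m1.
  by rewrite rm2 /update /= fr // mw.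
case: ifPn => [/and3P[x0 lsx le_x]|guard].
  split=> [y ys|s0].
    by rewrite /= cs3 /update /= rank_eq (negbTE ys) oth.
  have [ge le] := min s0.
  rewrite lab // in lsx.
  have -> : rmem (nset (den (FRSet 2 (counter 7) (RGet 0 (counter 8))) m3) 8 0
      (rank x).+1) 2 (rank s) = w x.
    by rewrite /= cs3 cx /update /= eqxx fr' // rm2 /update /= fr // mw.
  split; first by rewrite (comp_min_connect w s0 x0 lsx) comp_min_le.
  move=> y; rewrite !inE => /orP[/eqP -> //|yC] y0 sy.
  by apply: le_trans le_x (le y yC y0 sy).
split=> [y ys|s0] /=; first exact: oth.
have [ge le] := min s0; split=> // y; rewrite !inE => /orP[/eqP -> x0 sx|];
  last exact: le.
by move: guard; rewrite x0 lab // sx /= -ltNge => /ltW.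
Qed.

(** The running maximum over the pairs in [P]. It stays below every radius bound, and for universal
    [P] it is one itself, hence the [radius]. *)
Definition radius_upto (P : S -> S -> bool) d : Prop :=
  [/\ 0 <= d, forall d', radius_bound M S0 B w d' -> d <= d' &
      forall e f, P e f -> constrained M S0 B e f ->
        w f - comp_min M S0 w e <= 2 * d].

Lemma raise_radius_correct P m e f : constrained M S0 B e f ->
    input_ok m -> minima_ok m -> pair_at e f m -> radius_upto P (rmem m 3 0) ->
  radius_upto (fun a b => P a b || (a == e) && (b == f))
    (rmem (den raise_radius m) 3 0).
Proof.
move=> cst [_ _ mw] min [ce cf] [d0 dle dge].
have e0 : e \in S0.
  by case/orP: cst => [/and3P[]//|/andP[_ /and3P[/(subsetP sB)]]].
rewrite /raise_radius den_when.
have -> : beval m (BRle (RGet 3 (NCst 0)) half_gap) =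
    (rmem m 3 0 <= (w f - comp_min M S0 w e) / 2).
  by rewrite /= ce cf mw min.
case: leP => le_d.
  have -> : rmem (den (FRSet 3 (NCst 0) half_gap) m) 3 0 =
      (w f - comp_min M S0 w e) / 2.
    by rewrite /= ce cf mw min.
  split=> [|d' /[dup] /dle le' [_ bd']|a b].
  - by lra.
  - have := bd' _ _ cst; lra.
  case/orP => [Pab|/andP[/eqP -> /eqP ->] _]; last by lra.
  by move/(dge _ _ Pab); lra.
split=> // a b /orP[|/andP[/eqP -> /eqP ->] _]; first exact: dge.
lra.
Qed.

Lemma radius_step P m e f : input_ok m -> stores m 2 B -> pair_at e f m ->
    labels_ok m -> minima_ok m -> radius_upto P (rmem m 3 0) ->
  let m' := den
    (FSeq
      (FWhen (BAnd (nonzero 1 (counter 7)) (BAnd (nonzero 1 (counter 8))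
               (nat_eq (NGet 5 (counter 7)) (NGet 5 (counter 8)))))
        raise_radius)
      (on_exchange (FIf (nonzero 1 (counter 8)) FSkip raise_radius))) m in
  stores m' 2 B /\
  radius_upto (fun a b => P a b || (a == e) && (b == f)) (rmem m' 3 0).
Proof.
move=> m_ok mB ef lab min rad md; rewrite {}/md den_seq.
set p1 := FWhen _ _; set q := FIf _ _ _.
set P' := fun a b => _.
have [m0 m1 mw] := m_ok; have [ce cf] := ef.
have guardE : beval m (BAnd (nonzero 1 (counter 7))
    (BAnd (nonzero 1 (counter 8))
      (nat_eq (NGet 5 (counter 7)) (NGet 5 (counter 8))))) =
    [&& e \in S0, f \in S0 & label m e == label m f].
  by rewrite /= !leqn0 -eqn_leq ce cf !m1.
have weaken d : radius_upto P' d -> radius_upto P d.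
  by case=> d0 dle dge; split=> // a b Pab; apply: dge; rewrite /P' Pab.
(* The first block treats the pair exactly when it lies in a common component; exchanges leaving
   [S0] are left to the second. *)
have [rad1 rad1'] : radius_upto P (rmem (den p1 m) 3 0) /\
    ([&& e \in S0, f \in S0 & connect (circuit_rel M S0) e f] ->
      radius_upto P' (rmem (den p1 m) 3 0)).
  rewrite /p1 den_when guardE; case: ifPn => [/and3P[e0 f0 lef]|guard].
    rewrite lab // in lef.
    have radP : radius_upto P' (rmem (den raise_radius m) 3 0).
      by apply: raise_radius_correct => //; rewrite /constrained e0 f0 lef.
    by split=> //; apply: weaken.
  split=> // /and3P[e0 f0 cef]; case/negP: guard.
  by rewrite e0 f0 lab.
have unch := den_unchanged p1 m; set m2 := den p1 m in rad1 rad1' unch *.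
have [fn fr] := unch.
have mB2 : stores m2 2 B by move=> s; rewrite fn.
have ef2 : pair_at e f m2 by rewrite /pair_at !fn.
have [m3 [mB3 [fn3 fr3] ->]] := on_exchange_den q mB2 ef2.
have ef3 : pair_at e f m3 by rewrite /pair_at !fn3.
(* When the second block does nothing, the pair was either treated by the first or is not
   constrained. *)
have skip : ~~ (exchange M B e f && (f \notin S0)) ->
  radius_upto P' (rmem m3 3 0).
  move=> nx; rewrite fr3 //.
  have [/rad1' //|nc] :=
    boolP [&& e \in S0, f \in S0 & connect (circuit_rel M S0) e f].
  have [d0 dle dge] := rad1; split=> // a b.
  case/orP => [|/andP[/eqP -> /eqP ->]]; first exact: dge.
  by rewrite /constrained (negbTE nc) andbC (negbTE nx).
case: ifPn => [xef|nx]; last by split=> //; apply: skip; rewrite (negbTE nx).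
have -> : den q m3 = if f \in S0 then m3 else den raise_radius m3.
  by rewrite -m1 /q /= leqn0 !fn3 // !fn // cf.
case: ifPn => f0; first by split=> //; apply: skip; rewrite xef f0.
split; first by move=> s; rewrite den_nat_frame.
apply: raise_radius_correct => //.
- by rewrite /constrained f0 xef orbT.
- by apply: unchanged_input (conj fn3 fr3) _ (unchanged_input unch _ m_ok).
- by move=> s s0; rewrite fr3 // fr // min.
by rewrite fr3.
Qed.

Lemma compute_radius_correct m : input_ok m -> stores m 2 B -> labels_ok m ->
    minima_ok m -> rmem m 3 0 = 0 ->
  radius M S0 B w (rmem (den compute_radius m) 3 0).
Proof.
move=> m_ok mB lab min r0.
pose Inv (P : S -> S -> bool) m' :=
  stores m' 2 B /\ radius_upto P (rmem m' 3 0).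
suff [_ [d0 dle dge]] :
    Inv (fun a _ => a \in [set: S]%SET) (den compute_radius m).
  by split=> //; split=> // e f; apply: dge; rewrite inE.
apply: (for_invariant (Inv := fun A => Inv (fun a _ => a \in A))) => //.
- by case: m_ok.
- by split=> //=; rewrite r0; split=> [|d []|a b] //; rewrite inE.
move=> A e m2 eA unch ce I2; have [fn fr] := unch.
set body := FFor 8 _.
pose Inv2 (C : {set S}) := Inv (fun a b => (a \in A) || (a == e) && (b \in C)).
suff [mB2 [d0 dle dge]] : Inv2 [set: S]%SET (den body m2).
  split=> //; split=> // a b; rewrite !inE => ab; apply: dge.
  by rewrite inE andbT orbC.
have m_ok2 : input_ok m2 by apply: unchanged_input unch _ m_ok.
apply: for_invariant => //; first by case: m_ok2.
  case: I2 => mB2 [d0 dle dge]; split=> //; split=> // a b.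
  by rewrite inE andbF orbF; apply: dge.
move=> C f m3 fC unch' cf [mB3 rad3]; have [fn' fr'] := unch'.
have [||| mB4 [d0 dle dge]] :=
  @radius_step _ m3 e f (unchanged_input unch' isT m_ok2) mB3 _ _ _ rad3.
- by split=> //; rewrite fn'.
- by move=> x y x0 y0; rewrite !fn' // !fn // lab.
- by move=> s s0; rewrite fr' // fr // min.
split=> //; split=> // a b; rewrite !inE => ab; apply: dge.
by move: ab; case: (a \in A); case: (a == e); case: (b == f); case: (b \in C).
Qed.

Lemma output_optimum_correct m s : input_ok m -> minima_ok m ->
  rmem (den output_optimum m) 1 (rank s) = wopt M S0 w (rmem m 3 0) s.
Proof.
move=> [m0 m1 mw] min.
pose Inv A m' := forall t, t \in A -> rmem m' 1 (rank t) =
  wopt M S0 w (rmem m 3 0) t.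
suff : Inv [set: S]%SET (den output_optimum m) by apply; rewrite inE.
apply: for_invariant => // [t|A t m' tA [fn fr] ct IA x]; first by rewrite inE.
rewrite /= leqn0 ct fn // m1 !inE.
by have [->|xt /= xA] := eqVneq x t; case: ifPn => t0;
  rewrite /= /update /= rank_eq ?eqxx ?(negbTE xt) ?IA // /wopt ?t0 ?(negbTE t0)
    ?ct !fr ?mw ?min.
Qed.

End Basis.

Lemma output_input_correct m s : input_ok m ->
  rmem (den output_input m) 1 (rank s) = w s.
Proof.
move=> [m0 m1 mw].
pose Inv A m' := forall t, t \in A -> rmem m' 1 (rank t) = w t.
suff : Inv [set: S]%SET (den output_input m) by apply; rewrite inE.
apply: for_invariant => // [t|A t m' tA [fn fr] ct IA x]; first by rewrite inE.
rewrite /= ct fr // mw /update /= rank_eq !inE.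
by have [->|_ /=] := eqVneq x t; [|apply: IA].
Qed.

(** The initial zeros are the empty greedy set, the lowered flag and the starting radius. A raised
    flag means that no basis lies in [S0], where [wstar] is [w]; otherwise the greedy set is the
    basis to which the explicit formula is applied. *)
Lemma wstar_program_correct m s : input_ok m -> (forall i, nmem m 2 i = 0%N) ->
    nmem m 4 0 = 0%N -> rmem m 3 0 = 0 ->
  rmem (den wstar_program m) 1 (rank s) = wstar M S0 w s.
Proof.
move=> m_ok m2 m4 r3; rewrite /wstar_program den_seq.
have [I maxI m1I] := greedy_correct m_ok m2.
have unch1 := den_unchanged greedy m; set m1 := den greedy m in m1I unch1 *.
have m1_ok : input_ok m1 by apply: unchanged_input unch1 _ m_ok.
have [||m2I flag] := test_basis_correct _ _ m1I;
  [by case: m1_ok | by rewrite unch1.1 |].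
rewrite den_seq.
have unch2 := den_unchanged test_basis m1.
set m3 := den test_basis m1 in m2I flag unch2 *.
have m3_ok : input_ok m3 by apply: unchanged_input unch2 _ m1_ok.
set p := FSeq compute_labels _.
have -> : den (FIf (nonzero 4 (NCst 0)) output_input p) m3 =
    if nmem m3 4 0 != 0%N then den output_input m3 else den p m3.
  by rewrite -leqn0.
have := maximal_in_S0_basis maxI; rewrite flag; case: ifPn => _ bI.
  by rewrite wstar_no_basis // output_input_correct.
have sI : I \subset S0 by case: maxI.
rewrite /p den_seq.
have [m4I lab4] := compute_labels_correct bI sI m3_ok m2I.
have unch4 := den_unchanged compute_labels m3.
set m5 := den compute_labels m3 in m4I lab4 unch4 *.
have m5_ok : input_ok m5 by apply: unchanged_input unch4 _ m3_ok.
rewrite den_seq.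
have min6 := compute_minima_correct m5_ok lab4.
have unch6 := den_unchanged compute_minima m5.
set m6 := den compute_minima m5 in min6 unch6 *.
have m6_ok : input_ok m6 by apply: unchanged_input unch6 _ m5_ok.
have m6I : stores m6 2 I by move=> t; rewrite unch6.1.
have lab6 : labels_ok m6 by move=> x y x0 y0; rewrite !unch6.1 // lab4.
have r6 : rmem m6 3 0 = 0 by rewrite unch6.2 // unch4.2 // unch2.2 // unch1.2.
rewrite den_seq.
have rad := compute_radius_correct sI m6_ok m6I lab6 min6 r6.
have unch7 := den_unchanged compute_radius m6.
rewrite output_optimum_correct; first by rewrite (wstarE bI sI s rad).
  by apply: unchanged_input unch7 _ m6_ok.
by move=> t t0; rewrite unch7.2 // min6.
Qed.

End Correctness.

Lemma wstar_polytime (R : realType) : polytime_computable (@wstar R).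
Proof.
have [c [k cost_le]] := cost_polynomial wstar_program.
exists (compile wstar_program), c, k => S M S0 w.
pose m := input_memory S0 w.
have [t ex le_t] := exec_compile (indep_oracle M) m
  (isT : well_formed wstar_program) (isT : 0%N \notin nat_writes wstar_program).
exists (den (indep_oracle M) wstar_program m), t; split=> // [s|].
  apply: wstar_program_correct => //; split=> // x /=.
    by rewrite (nth_map x) ?nth_enum_rank ?nat_of_bool_neq0 // -cardE ltn_ord.
  by rewrite (nth_map x) ?nth_enum_rank // -cardE ltn_ord.
exact: leq_trans le_t (cost_le #|S|).
Qed.

Theorem theorem5p3 (R : realType) :
  (forall (S : finType) (M : matroid S) (S0 : {set S}) (w : S -> R),
     optimal_solution (im_all M S0) w (wstar M S0 w))
  /\ polytime_computable (@wstar R).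
Proof.
split; first exact: wstar_optimal.
exact: wstar_polytime.
Qed.
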